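(* Let $\mathcal{H}$ and $\mathcal{G}$ be real Hilbert spaces, $A_1:\mathcal{H}\rightrightarrows\mathcal{H}$ and $A_2:\mathcal{G}\rightrightarrows\mathcal{G}$ maximally monotone operators, $K:\mathcal{H}\to\mathcal{G}$ a linear continuous operator with adjoint $K^*$, $D:\mathcal{H}\to\mathcal{H}$ a monotone and $\eta^{-1}$-Lipschitz continuous operator with $\eta>0$, $B:\mathcal{H}\to\mathcal{H}$ a monotone and $\mu^{-1}$-Lipschitz continuous operator with $\mu>0$, and suppose $C=\operatorname{zer}B\neq\emptyset$. Let $(\lambda_n)_{n\ge1}$ and $(\beta_n)_{n\ge1}$ be sequences of positive real numbers, let $(x_1,v_1)\in\mathcal{H}\times\mathcal{G}$ and let $(x_n)_{n\ge1}$, $(v_n)_{n\ge1}$, $(p_n)_{n\ge1}$, $(q_n)_{n\ge1}$ be generated, for all $n\ge1$, by $$\begin{aligned} p_n&=J_{\lambda_nA_1}\big(x_n-\lambda_n(Dx_n+K^*v_n)-\lambda_n\beta_nBx_n\big),\\ q_n&=J_{\lambda_nA_2^{-1}}(v_n+\lambda_nKx_n),\\ x_{n+1}&=\lambda_n\beta_n(Bx_n-Bp_n)+\lambda_n(Dx_n-Dp_n)+\lambda_nK^*(v_n-q_n)+p_n,\\ v_{n+1}&=\lambda_nK(p_n-x_n)+q_n . \end{aligned}$$ Set $\tau_n=\sum_{k=1}^n\lambda_k$ and $z_n=\frac1{\tau_n}\sum_{k=1}^n\lambda_kx_k$. Assume that: (1) $A_1+N_C$ is maximally monotone and $\operatorname{zer}(A_1+K^*A_2K+D+N_C)\neq\emptyset$;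 (2) for every $p\in\operatorname{ran}N_C$, $\ \sum_{n\ge1}\lambda_n\beta_n\left[\sup_{u\in C}\varphi_B\left(u,\frac{p}{\beta_n}\right)-\sigma_C\left(\frac{p}{\beta_n}\right)\right]<+\infty$; (3) $(\lambda_n)_{n\ge1}\in\ell^2\setminus\ell^1$; (4) $\limsup_{n\to+\infty}\left(\frac{\lambda_n\beta_n}{\mu}+\lambda_n\sqrt{2\left(\frac{1}{\eta^2}+\|K\|^2\right)}\right)<1$. Then $(z_n)_{n\ge1}$ converges weakly to an element of $\operatorname{zer}(A_1+K^*A_2K+D+N_C)$ as $n\to+\infty$. If, additionally, $A_1$ and $A_2^{-1}$ are strongly monotone, then $(x_n)_{n\ge1}$ converges strongly to the unique element of $\operatorname{zer}(A_1+K^*A_2K+D+N_C)$ as $n\to+\infty$.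
   Context: For a set-valued operator $M$ on a real Hilbert space: $\operatorname{Gr}M=\{(x,u):u\in Mx\}$, $\operatorname{ran}M=\{u:\exists x,\ u\in Mx\}$, $\operatorname{zer}M=\{x:0\in Mx\}$, $M^{-1}$ is the inverse operator ($(u,x)\in\operatorname{Gr}M^{-1}$ iff $(x,u)\in\operatorname{Gr}M$), and $J_M=(\mathrm{Id}+M)^{-1}$ is the resolvent (single-valued and everywhere defined when $M$ is maximally monotone). $M$ is monotone if $\langle x-y,u-v\rangle\ge0$ for all $(x,u),(y,v)\in\operatorname{Gr}M$; maximally monotone if its graph has no proper monotone extension; strongly monotone if for some $\gamma>0$, $\langle x-y,u-v\rangle\ge\gamma\|x-y\|^2$ for all $(x,u),(y,v)\in\operatorname{Gr}M$. The normal cone of $C$ is $N_C(x)=\{u:\langle u,y-x\rangle\le0\ \forall y\in C\}$ if $x\in C$ and $N_C(x)=\emptyset$ otherwise; the support function is $\sigma_C(u)=\sup_{y\in C}\langle y,u\rangle$. The Fitzpatrick function of a monotone operator $M$ is $\varphi_M(x,u)=\sup_{(y,v)\in\operatorname{Gr}M}\{\langle x,v\rangle+\langle y,u\rangle-\langle y,v\rangle\}$, with values in the extended reals. $\|K\|$ is the operator norm. *)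

(* Defs.v *)
From HB Require Import structures.
From mathcomp Require Import all_boot all_order all_algebra.
From mathcomp Require Import all_classical all_reals all_analysis.

Set Implicit Arguments.
Unset Strict Implicit.
Unset Printing Implicit Defensive.

Import Order.TTheory GRing.Theory Num.Theory.
Import numFieldNormedType.Exports.

Local Open Scope classical_set_scope.
Local Open Scope ring_scope.

(* A real Hilbert space: a complete normed module whose norm comes from a
   symmetric, bilinear, positive definite form. *)
HB.mixin Record CompleteNormedModule_isHilbert (R : realType) H
    of CompleteNormedModule R H := {
  inner : {dot H for (@idfun R)} ;
  inner_norm : forall x : H, inner x x = `|x| ^+ 2
}.

#[short(type="hilbertType")]
HB.structure Definition Hilbert (R : realType) :=
  {H of CompleteNormedModule R H & CompleteNormedModule_isHilbert R H}.

Definition weakly_cvg (R : realType) (H : hilbertType R) (u : nat -> H)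
    (l : H) : Prop :=
  forall y : H, (fun n => inner (u n) y) @ \oo --> inner l y.

(* The value at v is characterized by inner (K x) v = inner x (adjoint K v) for
   all x; it exists by the Riesz representation theorem if K is linear and
   continuous (the default value 0 is then irrelevant). *)
Definition adjoint (R : realType) (H G : hilbertType R) (K : H -> G)
    (v : G) : H :=
  xget 0 [set u | forall x, inner (K x) v = inner x u].

Definition opnorm (R : realType) (H G : hilbertType R) (K : H -> G) : R :=
  sup [set `|K x| | x in [set x : H | `|x| <= 1]].

(* A set-valued operator from H to G is a function H -> set G. *)
Definition gr (H G : Type) (M : H -> set G) : set (H * G) :=
  [set p | M p.1 p.2].

Definition ran (H G : Type) (M : H -> set G) : set G :=
  [set u | exists x, M x u].

Definition zer (H : Type) (G : zmodType) (M : H -> set G) : set H :=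
  [set x | M x 0].

Definition inv_op (H G : Type) (M : H -> set G) : G -> set H :=
  fun u => [set x | M x u].

Definition fun_op (H G : Type) (f : H -> G) : H -> set G :=
  fun x => [set f x].

Definition add_op (H : Type) (G : zmodType) (M N : H -> set G) : H -> set G :=
  fun x => [set u + v | u in M x & v in N x].

Definition scale_op (R : realType) (H : Type) (G : lmodType R) (a : R)
    (M : H -> set G) : H -> set G :=
  fun x => [set a *: u | u in M x].

(* (Id + M)^-1 as a set-valued operator; its values are singletons when M is
   maximally monotone. *)
Definition resolvent (H : zmodType) (M : H -> set H) : H -> set H :=
  inv_op (add_op (fun_op idfun) M).

Definition monotone_op (R : realType) (H : hilbertType R) (M : H -> set H) :
    Prop :=
  forall x u y v : H, gr M (x, u) -> gr M (y, v) ->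
    0 <= inner (x - y) (u - v).

Definition maximally_monotone_op (R : realType) (H : hilbertType R)
    (M : H -> set H) : Prop :=
  monotone_op M /\
  forall N : H -> set H, monotone_op N -> gr M `<=` gr N ->
    gr N = gr M.

Definition strongly_monotone_op (R : realType) (H : hilbertType R)
    (M : H -> set H) : Prop :=
  exists2 gamma : R, 0 < gamma &
    forall x u y v : H, gr M (x, u) -> gr M (y, v) ->
      gamma * `|x - y| ^+ 2 <= inner (x - y) (u - v).

Definition normal_cone (R : realType) (H : hilbertType R) (C : set H) :
    H -> set H :=
  fun x => [set u | C x /\ forall y, C y -> inner u (y - x) <= 0].

Definition support_fun (R : realType) (H : hilbertType R) (C : set H)
    (u : H) : \bar R :=
  ereal_sup [set (inner y u)%:E | y in C].

Definition fitzpatrick (R : realType) (H : hilbertType R) (M : H -> set H)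
    (x u : H) : \bar R :=
  ereal_sup [set (inner x p.2 + inner p.1 u - inner p.1 p.2)%:E
            | p in gr M].

(* l^p membership; the sequence is indexed from 1 and a 0 is ignored. *)
Definition in_ell (R : realType) (p : nat) (a : nat -> R) : Prop :=
  ((\sum_(1 <= n <oo) (`|a n| ^+ p)%:E)%E < +oo)%E.

Definition weighted_mean (R : realType) (H : lmodType R) (lambda : nat -> R)
    (x : nat -> H) (n : nat) : H :=
  (\sum_(1 <= k < n.+1) lambda k)^-1 *: \sum_(1 <= k < n.+1) lambda k *: x k.

Definition inclusion_op (R : realType) (H G : hilbertType R)
    (A1 : H -> set H) (A2 : G -> set G) (K : H -> G) (D : H -> H)
    (C : set H) : H -> set H :=
  add_op (add_op (add_op A1 (fun x => adjoint K @` A2 (K x))) (fun_op D))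
    (normal_cone C).

(* Main.v *)
(* In H * G, with the monotone operators (A1, A2^-1), (B, 0) and the sum of
   (D, 0) and the skew operator (x, v) |-> (K^* v, - K x), the scheme is Tseng's
   forward-backward-forward method with penalty term beta_n B. Test the
   resolvent inclusions against a point (u, w) of the domain of the summed
   operator, with normal cone part c in N_C u. The penalty enters the resulting
   inequality only through <u - p_n, B p_n> + <p_n - u, c / beta_n>, which is at
   most the Fitzpatrick function minus the support function, so that the error
   is summable by (2). At zeros the inequality is quasi-Fejer and the distances
   converge; at general points, summing it and dividing by tau_n shows that weak
   cluster points of the ergodic means are monotonically related to the graph of
   the sum, hence are zeros by Minty's theorem. The Opial-Passty argument
   concludes. Under strong monotonicity the series of
   lambda_n |(x_n, v_n) - (u, w)|^2 converges while that of lambda_n diverges,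
   so the limit distance is 0. *)

Require Import Defs.
From HB Require Import structures.
From mathcomp Require Import all_boot all_order all_algebra.
From mathcomp Require Import all_classical all_reals all_analysis.
From mathcomp Require Import ring lra.

Set Implicit Arguments.
Unset Strict Implicit.
Unset Printing Implicit Defensive.

Import Order.TTheory GRing.Theory Num.Theory.
Import numFieldNormedType.Exports.

Local Open Scope classical_set_scope.
Local Open Scope ring_scope.

(** * Inner products and minimization *)

Section inner_theory.
Variables (R : realType) (H : hilbertType R).
Implicit Types x y z : H.

Lemma innerC x y : inner x y = inner y x.
Proof. by rewrite hermC expr0 mul1r. Qed.

Lemma innerDl x y z : inner (x + y) z = inner x z + inner y z.
Proof. exact: linearDl. Qed.

Lemma innerDr x y z : inner z (x + y) = inner z x + inner z y.
Proof. exact: linearDr. Qed.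

Lemma innerNl x y : inner (- x) y = - inner x y.
Proof. exact: linearNl. Qed.

Lemma innerNr x y : inner y (- x) = - inner y x.
Proof. exact: linearNr. Qed.

Lemma innerBl x y z : inner (x - y) z = inner x z - inner y z.
Proof. exact: linearBl. Qed.

Lemma innerBr x y z : inner z (x - y) = inner z x - inner z y.
Proof. exact: linearBr. Qed.

Lemma innerZl (a : R) x y : inner (a *: x) y = a * inner x y.
Proof. exact: linearZl_LR. Qed.

Lemma innerZr (a : R) x y : inner y (a *: x) = a * inner y x.
Proof. exact: linearZr_LR. Qed.

Lemma inner0l x : inner 0 x = 0.
Proof. exact: linear0l. Qed.

Lemma inner0r x : inner x 0 = 0.
Proof. exact: linear0r. Qed.

Lemma inner_suml (I : Type) (r : seq I) (P : pred I) (f : I -> H) y :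
  inner (\sum_(i <- r | P i) f i) y = \sum_(i <- r | P i) inner (f i) y.
Proof. exact: linear_sumlz. Qed.

Lemma sqr_normD x y : `|x + y| ^+ 2 = `|x| ^+ 2 + 2 * inner x y + `|y| ^+ 2.
Proof. by rewrite -!inner_norm innerDl !innerDr (innerC y x); ring. Qed.

Lemma sqr_normB x y : `|x - y| ^+ 2 = `|x| ^+ 2 - 2 * inner x y + `|y| ^+ 2.
Proof. by rewrite sqr_normD normrN innerNr mulrN. Qed.

(** Cauchy-Schwarz: the squared distance from [y] to its projection on the line through [x] is
    nonnegative. *)
Lemma ler_norm_inner x y : `|inner x y| <= `|x| * `|y|.
Proof.
have [->|x0] := eqVneq x 0; first by rewrite inner0l !normr0 mul0r.
rewrite -ler_sqr ?nnegrE ?mulr_ge0 // real_normK ?num_real // exprMn.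
have nx : 0 < `|x| ^+ 2 by rewrite exprn_gt0 // normr_gt0.
have /(mulr_ge0 (ltW nx)) := sqr_ge0 `|(inner x y / `|x| ^+ 2) *: x - y|.
rewrite sqr_normB normrZ exprMn real_normK ?num_real // innerZl.
suff -> : `|x| ^+ 2 * ((inner x y / `|x| ^+ 2) ^+ 2 * `|x| ^+ 2
   - 2 * (inner x y / `|x| ^+ 2 * inner x y) + `|y| ^+ 2) =
   `|x| ^+ 2 * `|y| ^+ 2 - inner x y ^+ 2 by rewrite subr_ge0.
by field; rewrite normr_eq0.
Qed.

Lemma inner_injr x y : (forall z, inner z x = inner z y) -> x = y.
Proof.
move=> xy; apply/eqP; rewrite -subr_eq0 -normr_eq0 -sqrf_eq0 -inner_norm.
by rewrite innerBr xy subrr.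
Qed.

Lemma inner_continuousl y : continuous (fun x : H => inner x y).
Proof.
move=> x; apply/cvgrPdist_le => e e0.
have y0 : 0 < `|y| + 1 by rewrite ltr_wpDl.
near=> z; rewrite -innerBl (le_trans (ler_norm_inner _ _))//.
apply: (@le_trans _ _ (`|x - z| * (`|y| + 1))).
  by rewrite ler_wpM2l // lerDl.
rewrite -ler_pdivlMr //; near: z.
by apply: (@cvgr_dist_le _ _ _ _ _ idfun); [exact: cvg_id | exact: divr_gt0].
Unshelve. all: by end_near. Qed.

Lemma inner_continuousr x : continuous (fun y : H => inner x y).
Proof.
by under eq_fun do rewrite innerC; exact: inner_continuousl.
Qed.

Lemma cvg_innerl (T : Type) (F : set_system T) (FF : Filter F) (f : T -> H) x y :
  f @ F --> x -> inner (f t) y @[t --> F] --> inner x y.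
Proof. by move=> fx; exact: (cvg_comp _ _ fx (@inner_continuousl y x)). Qed.

Lemma cvg_innerr (T : Type) (F : set_system T) (FF : Filter F) (f : T -> H) x y :
  f @ F --> x -> inner y (f t) @[t --> F] --> inner y x.
Proof. by move=> fx; exact: (cvg_comp _ _ fx (@inner_continuousr y x)). Qed.

End inner_theory.

(* Epigraph form of the fact that a lower semicontinuous, uniformly convex
   function bounded below attains its minimum: minimizing sequences are
   Cauchy. *)
Lemma strongly_convex_minimizer (R : realType) (E : completeNormedModType R)
    (P : E -> R -> Prop) (c : R) : 0 < c ->
  (exists x r, P x r) -> (exists m, forall x r, P x r -> m <= r) ->
  (forall x y r s, P x r -> P y s ->
    P (2^-1 *: (x + y)) ((r + s) / 2 - c * `|x - y| ^+ 2)) ->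
  (forall (u : nat -> E) (r : nat -> R) x m, (forall n, P (u n) (r n)) ->
    u @ \oo --> x -> r @ \oo --> m -> P x m) ->
  exists x m, P x m /\ forall y r, P y r -> m <= r.
Proof.
move=> c0 [x0 [r0 P0]] [m0 Pm0] Pmid Pcl.
pose S := [set r | exists x, P x r].
have Sinf : has_inf S.
  by split; [exists r0, x0 | exists m0 => r [x]; exact: Pm0].
pose m := inf S.
have mP y r : P y r -> m <= r.
  by move=> Pyr; apply: (ge_inf Sinf.2); exists y.
have /choice[w wP] n : exists w : E * R, P w.1 w.2 /\ w.2 < m + n.+1%:R^-1.
  have [r [x Pxr] rm] := inf_adherent (ltac:(by []) : 0 < n.+1%:R^-1 :> R) Sinf.
  by exists (x, r).
have r_cvg : (fun n => (w n).2) @ \oo --> m.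
  apply: (@squeeze_cvgr _ _ _ _ (fun=> m) (fun n => m + n.+1%:R^-1)).
  - by near=> n; have [/mP -> /ltW ->] := wP n.
  - exact: cvg_cst.
  - rewrite -[X in _ --> X]addr0; apply: cvgD; first exact: cvg_cst.
    exact: cvg_harmonic.
(* The midpoint value is at least [m], while both values exceed [m] by less than a harmonic term;
   this bounds the convexity gain. *)
have dist n k : c * `|(w n).1 - (w k).1| ^+ 2 <= (n.+1%:R^-1 + k.+1%:R^-1) / 2.
  have [Pn rn] := wP n; have [Pk rk] := wP k.
  have := mP _ _ (Pmid _ _ _ _ Pn Pk); move: rn rk; rewrite -/m; clearbody m.
  move: (_ ^-1) (_ ^-1)=> a b. clear; lra.
have u_cvg : cvgn (fun n => (w n).1).
  apply/cauchy_cvgP/cauchy_ballP => e e0.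
  have ce : 0 < c * e ^+ 2 by rewrite mulr_gt0 // exprn_gt0.
  have [N _ NP] := near_infty_natSinv_lt (PosNum ce).
  pose A := (fun n => (w n).1) @` [set n | (N <= n)%N].
  exists (A, A); first by split; exists N => // n Nn; exists n.
  move=> [_ _] [] /= [n Nn <-] [k Nk <-].
  rewrite -ball_normE /ball_ /=.
  rewrite -ltr_sqr ?nnegrE ?normr_ge0 ?(ltW e0) // -(ltr_pM2l c0).
  apply: (le_lt_trans (dist n k)).
  have := NP n Nn; have := NP k Nk; rewrite /=.
  move: (n.+1%:R^-1) (k.+1%:R^-1) => a b; clear; lra.
move/cvg_ex : u_cvg => [l ul]; exists l, m; split=> //.
by apply: (Pcl (fun n => (w n).1) (fun n => (w n).2)) => // n; have [] := wP n.
Unshelve. all: by end_near. Qed.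

(** * Riesz representation and adjoints *)

(** First-order condition at a minimum: at [t = - a / (b + 1)] the expression equals minus the
    square of [a / (b + 1)]. *)
Lemma linear_perturbation_eq0 (R : realFieldType) (a b : R) : 0 <= b ->
  (forall t, 0 <= t * a + t ^+ 2 * b) -> a = 0.
Proof.
move=> b0 /(_ (- a / (b + 1))).
have b1 : 0 < b + 1 by rewrite ltr_wpDl.
rewrite (_ : _ + _ = - (a / (b + 1)) ^+ 2); last by field; rewrite gt_eqF.
rewrite oppr_ge0 => h; apply/eqP.
have : (a / (b + 1)) ^+ 2 == 0 by rewrite eq_le h sqr_ge0.
by rewrite sqrf_eq0 mulf_eq0 invr_eq0 (gt_eqF b1) orbF.
Qed.

Section riesz.
Variables (R : realType) (H : hilbertType R).

(** The parallelogram law, arranged as the midpoint gain that [strongly_convex_minimizer] asks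
    for. *)
Lemma sqr_norm_midpoint (x y : H) :
  `|2^-1 *: (x + y)| ^+ 2 = (`|x| ^+ 2 + `|y| ^+ 2) / 2 - 4^-1 * `|x - y| ^+ 2.
Proof.
rewrite normrZ exprMn (sqr_normD x y) sqr_normB ger0_norm ?invr_ge0 //.
by field.
Qed.

(** The representing vector minimizes half the squared norm minus [f]; the vanishing of directional
    derivatives at the minimizer is the claim. *)
Lemma riesz_representation (f : H -> R) :
  {morph f : x y / x + y} -> (forall a x, f (a *: x) = a * f x) ->
  (exists M, forall x, `|f x| <= M * `|x|) ->
  exists z, forall x, f x = inner x z.
Proof.
move=> fD fZ [M fM].
have [|||||z [m [Pz minz]]] := @strongly_convex_minimizer R H
  (fun x r => 2^-1 * `|x| ^+ 2 - f x <= r) 8^-1.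
- by [].
- by exists 0, (2^-1 * `|0 : H| ^+ 2 - f 0).
- exists (- (2^-1 * M ^+ 2)) => x r; apply: le_trans.
  have := ler_norm (f x); have := fM x; have := sqr_ge0 (`|x| - M); nra.
- move=> x y r s; rewrite sqr_norm_midpoint fZ fD; lra.
- move=> u r x m Pur ux rm.
  have f_cvg : f (u n) @[n --> \oo] --> f x.
    apply/cvgrPdist_le => e e0; near=> n.
    rewrite -[f x - _]/(f x + - f (u n)) -mulN1r -fZ scaleN1r -fD.
    apply: (le_trans (fM _)); apply: (@le_trans _ _ ((`|M| + 1) * `|x - u n|)).
      by rewrite ler_wpM2r // (le_trans (ler_norm M)) // lerDl.
    rewrite -ler_pdivlMl ?ltr_wpDl // mulrC; near: n.
    by move/cvgrPdist_le : ux; apply; rewrite divr_gt0 ?ltr_wpDl.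
  apply: (@ler_cvg_to _ \oo _ _ (fun n => 2^-1 * `|u n| ^+ 2 - f (u n)) r) => //.
  - apply: cvgB => //; apply: cvgMr; rewrite expr2.
    by under eq_fun do rewrite expr2; apply: cvgM; apply: cvg_norm.
  - by near=> n; exact: Pur.
exists z => y; apply/eqP; rewrite eq_sym -subr_eq0 innerC; apply/eqP.
apply: (@linear_perturbation_eq0 _ _ (2^-1 * `|y| ^+ 2)) => [|t].
  by rewrite mulr_ge0 ?invr_ge0 ?exprn_ge0.
have := le_trans (minz _ _ Pz) (minz (z + t *: y) _ (lexx _)).
have := minz (z + t *: y) _ (lexx _); move: Pz.
rewrite fD fZ sqr_normD innerZr normrZ exprMn real_normK ?num_real //; lra.
Unshelve. all: by end_near. Qed.

End riesz.

Section adjoint_theory.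
Variables (R : realType) (H G : hilbertType R) (K : {linear H -> G}).
Hypothesis K_cont : continuous K.

(** Continuity bounds [K] on the unit ball, so that the [sup] in [opnorm] is a true least upper
    bound. *)
Lemma ler_opnorm_unit x : `|x| <= 1 -> `|K x| <= opnorm K.
Proof.
have [|r [_ Kr]] := (linear_boundedP K).1.
  by apply/linear_bounded_continuous.
have {}Kr y : `|K y| <= (r + 1) * `|y| by apply: Kr; rewrite ltrDl.
move=> x1; apply: ub_le_sup; last by exists x.
exists `|r + 1| => _ [y /= y1 <-]; apply: (le_trans (Kr y)).
rewrite -[leRHS]mulr1; apply: (@le_trans _ _ (`|r + 1| * `|y|)).
  by rewrite ler_wpM2r // ler_norm.
by rewrite ler_wpM2l.
Qed.

Lemma opnorm_ge0 : 0 <= opnorm K.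
Proof. by apply: le_trans (ler_opnorm_unit (x := 0) _); rewrite ?normr0. Qed.

Lemma ler_opnorm x : `|K x| <= opnorm K * `|x|.
Proof.
have [->|x0] := eqVneq x 0; first by rewrite linear0 !normr0 mulr0.
have nx : 0 < `|x| by rewrite normr_gt0.
rewrite -ler_pdivrMr //.
have := @ler_opnorm_unit (`|x|^-1 *: x).
rewrite linearZ /= !normrZ normfV normr_id mulVf ?gt_eqF // mulrC.
by apply.
Qed.

(** Riesz representation of [x |-> inner (K x) v] rules out the default value in [adjoint]. *)
Lemma inner_adjoint x v : inner (K x) v = inner x (adjoint K v).
Proof.
rewrite /adjoint; case: xgetP => [u -> //|noadj].
have [|||z zP] := @riesz_representation _ _ (fun x => inner (K x) v).
- by move=> y z; rewrite linearD innerDl.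
- by move=> a y; rewrite linearZ innerZl.
- exists (opnorm K * `|v|) => y.
  apply: (le_trans (ler_norm_inner _ _)).
  by rewrite mulrAC ler_wpM2r // ler_opnorm.
by have := noadj z; case.
Qed.

Lemma adjointB v w : adjoint K (v - w) = adjoint K v - adjoint K w.
Proof.
by apply: inner_injr => x; rewrite innerBr -!inner_adjoint innerBr.
Qed.

Lemma ler_norm_adjoint v : `|adjoint K v| <= opnorm K * `|v|.
Proof.
have [->|x0] := eqVneq (adjoint K v) 0.
  by rewrite normr0 mulr_ge0 // opnorm_ge0.
have nx : 0 < `|adjoint K v| by rewrite normr_gt0.
rewrite -(ler_pM2r nx) -expr2 -inner_norm -inner_adjoint.
apply: (le_trans (ler_norm _)); apply: (le_trans (ler_norm_inner _ _)).
by rewrite mulrAC ler_wpM2r // ler_opnorm.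
Qed.

End adjoint_theory.

(** * Minty's theorem *)

HB.instance Definition _ (R : realType) (E F : completeNormedModType R) :=
  Pointed.on (E * F)%type.

(** Both projections of a Cauchy filter are Cauchy, and their limits form the limit of the filter.
    Completeness of the product lets [minty0] minimize over pairs. *)
Lemma prod_cauchy_cvg (R : realType) (E F : completeNormedModType R)
    (Fil : set_system (E * F)) : ProperFilter Fil -> cauchy Fil -> cvg Fil.
Proof.
move=> FF Fc.
have /cauchy_cvgP/cvg_ex[x Fx] : cauchy (fst @ Fil).
  apply/cauchy_ballP => e e0; have /cauchy_ballP/(_ e e0)[[A B] /= [FA FB] AB] := Fc.
  exists (fst @` A, fst @` B).
    by split; [apply: filterS FA|apply: filterS FB] => z Az /=; exists z.
  by move=> [_ _] /= [[a Aa <-] [b Bb <-]]; have [] := AB (a, b) (conj Aa Bb).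
have /cauchy_cvgP/cvg_ex[y Fy] : cauchy (snd @ Fil).
  apply/cauchy_ballP => e e0; have /cauchy_ballP/(_ e e0)[[A B] /= [FA FB] AB] := Fc.
  exists (snd @` A, snd @` B).
    by split; [apply: filterS FA|apply: filterS FB] => z Az /=; exists z.
  by move=> [_ _] /= [[a Aa <-] [b Bb <-]]; have [] := AB (a, b) (conj Aa Bb).
apply/cvg_ex; exists (x, y).
move=> A /(cvg_pair Fx Fy).
by have -> : (fun z => (z.1, z.2)) = @id (E * F)%type by apply/funext => -[].
Qed.

HB.instance Definition _ (R : realType) (E F : completeNormedModType R) :=
  Uniform_isComplete.Build (E * F)%type (@prod_cauchy_cvg R E F).

(** One-sided first-order condition, for perturbations along a segment. If [a < 0], then
    [t = - a / (b - a)] is admissible and gives a negative value. *)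
Lemma right_perturbation_ge0 (R : realFieldType) (a b : R) : 0 <= b ->
  (forall t, 0 < t <= 1 -> 0 <= t * a + t ^+ 2 * b) -> 0 <= a.
Proof.
move=> b0 tab; rewrite leNgt; apply/negP => a0.
have b1 : 0 < b - a by lra.
have /tab : 0 < - a / (b - a) <= 1.
  by rewrite divr_gt0 ?oppr_gt0 //= ler_pdivrMr //; lra.
rewrite (_ : _ + _ = - (a ^+ 2 * (- a) / (b - a) ^+ 2)); last first.
  by field; rewrite gt_eqF.
rewrite leNgt oppr_lt0 divr_gt0 ?exprn_gt0 // mulr_gt0 ?oppr_gt0 //.
by rewrite lt_neqAle sqr_ge0 eq_sym sqrf_eq0 lt_eqF.
Qed.

Section minty.
Variables (R : realType) (H : hilbertType R).

(** Adjoining [(x, u)] to the graph preserves monotonicity, so maximality forces the pair to be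
    there already. *)
Lemma maximally_monotone_mem (M : H -> set H) (x u : H) :
  maximally_monotone_op M ->
  (forall y v, M y v -> 0 <= inner (x - y) (u - v)) -> M x u.
Proof.
move=> [Mmono Mmax] xu.
pose N y := [set v | M y v \/ (y = x /\ v = u)].
have Nmono : monotone_op N.
  move=> y v y' v' [Myv|/= [-> ->]] [Myv'|/= [-> ->]].
  - exact: (Mmono _ _ _ _ Myv Myv').
  - by rewrite -opprB -(opprB u) innerNl innerNr opprK xu.
  - exact: xu.
  - by rewrite subrr inner0l.
have MN : gr M `<=` gr N by move=> [y v] Myv; left.
have : gr N (x, u) by right.
by rewrite (Mmax N Nmono MN).
Qed.

Lemma sqr_norm_convex (t : R) (x y : H) :
  `|(1 - t) *: x + t *: y| ^+ 2 =
  (1 - t) * `|x| ^+ 2 + t * `|y| ^+ 2 - t * (1 - t) * `|x - y| ^+ 2.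
Proof.
rewrite !(sqr_normD ((1 - t) *: x)) sqr_normB !normrZ !exprMn.
rewrite !real_normK ?num_real // innerZl innerZr; ring.
Qed.

(** The product carries the max norm. This turns the midpoint gains of the two coordinates into a
    gain in the norm of the pair. *)
Lemma sqr_norm_pair (a b : H) :
  `|(a, b)| ^+ 2 <= `|a| ^+ 2 + `|b| ^+ 2.
Proof.
rewrite prod_normE /= /Num.max; case: ifP => _; rewrite ?lerDl ?lerDr;
  exact: sqr_ge0.
Qed.

(* The minimizer (x, u) of the Fitzpatrick function plus half the squared norm
   satisfies (-u, -x) in gr T and x + u = 0. *)
Lemma minty0 (T : H -> set H) : maximally_monotone_op T ->
  exists x, T x (- x).
Proof.
move=> Tmax; have Tmono := Tmax.1.
(* With an empty graph, [(0, 0)] would be vacuously related to it, hence in it. *)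
have [y0 [v0 Tyv0]] : exists y0 v0, T y0 v0.
  apply: contrapT => T0; apply: (T0); exists 0, 0.
  apply: maximally_monotone_mem => // y v Tyv; exfalso; apply: T0.
  by exists y, v.
(* The epigraph of the function to minimize, with the supremum in the Fitzpatrick function replaced
   by a bound on every term; all values stay real. *)
pose P (z : H * H) (r : R) := forall y v, T y v ->
  2^-1 * (`|z.1| ^+ 2 + `|z.2| ^+ 2) + inner z.1 v + inner y z.2 - inner y v
  <= r.
have Pgr y v : T y v -> P (y, v) (2^-1 * (`|y| ^+ 2 + `|v| ^+ 2) + inner y v).
  move=> Tyv y' v' Tyv'; have := Tmono _ _ _ _ Tyv Tyv'.
  rewrite innerBl !innerBr /=; lra.
have [|||||[x u] [m [Pm minm]]] := @strongly_convex_minimizer R _ P 8^-1.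
- by [].
- by exists (y0, v0); eexists; exact: Pgr.
- exists (- 2^-1 * (`|y0| ^+ 2 + `|v0| ^+ 2) - inner y0 v0) => -[x u] r Pr.
  have := Pr _ _ Tyv0; have := sqr_ge0 `|x + v0|; have := sqr_ge0 `|y0 + u|.
  rewrite !sqr_normD /=; lra.
- move=> [x u] [x' u'] r s Pr Ps y v Tyv.
  have := Pr _ _ Tyv; have := Ps _ _ Tyv; have := sqr_norm_pair (x - x') (u - u').
  rewrite /= !sqr_norm_midpoint innerZl innerZr innerDl innerDr.
  rewrite -[(x - x', u - u')]/((x, u) - (x', u')); lra.
- move=> w r [x u] m Pw wx rm y v Tyv.
  have w1 : (w n).1 @[n --> \oo] --> x by exact: (cvg_comp _ _ wx cvg_fst).
  have w2 : (w n).2 @[n --> \oo] --> u by exact: (cvg_comp _ _ wx cvg_snd).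
  apply: (ler_cvg_to _ rm); last first.
    by near=> n; exact: Pw Tyv.
  apply: cvgB; last exact: cvg_cst.
  apply: cvgD; last exact: cvg_innerr.
  apply: cvgD; last exact: cvg_innerl.
  apply: cvgMr; rewrite !expr2; under eq_fun do rewrite !expr2.
  by apply: cvgD; apply: cvgM; apply: cvg_norm.
(* The Fitzpatrick function dominates the duality product: if it did not at [(x, u)], this pair
   would be in the graph, and testing [Pm] against the pair itself would contradict [m_lt]. *)
have F_ge : inner x u + 2^-1 * (`|x| ^+ 2 + `|u| ^+ 2) <= m.
  rewrite leNgt; apply/negP => m_lt.
  have Txu : T x u.
    apply: maximally_monotone_mem => // y v /Pm /=.
    rewrite innerBl !innerBr; lra.
  have := Pm _ _ Txu => /=; lra.
(* Minimality along the segment from [(x, u)] to the graph point [(y, v)], combined with [F_ge]. *)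
have xu_mono y v : T y v -> `|x + u| ^+ 2 <= inner (- u - y) (- x - v).
  move=> Tyv.
  suff : 0 <= inner y v + 2^-1 * (`|y| ^+ 2 + `|v| ^+ 2) - m
            - 2^-1 * (`|x - y| ^+ 2 + `|u - v| ^+ 2).
    rewrite !sqr_normB sqr_normD innerBl !innerBr !innerNl !innerNr.
    rewrite (innerC u x) (innerC y x); lra.
  apply: (@right_perturbation_ge0 _ _ (2^-1 * (`|x - y| ^+ 2 + `|u - v| ^+ 2))).
    by rewrite mulr_ge0 ?invr_ge0 ?addr_ge0 ?sqr_ge0.
  move=> t /andP[t0 t1].
  suff /minm : P ((1 - t) *: x + t *: y, (1 - t) *: u + t *: v)
      ((1 - t) * m + t * (2^-1 * (`|y| ^+ 2 + `|v| ^+ 2) + inner y v)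
       - t * (1 - t) * (2^-1 * (`|x - y| ^+ 2 + `|u - v| ^+ 2))) by lra.
  move=> y' v' Tyv'; rewrite /= !sqr_norm_convex.
  have := ler_wpM2l (_ : 0 <= 1 - t) (Pm _ _ Tyv').
  have := ler_wpM2l (ltW t0) (Pgr _ _ Tyv _ _ Tyv').
  rewrite /= innerDl innerDr !innerZl !innerZr subr_ge0 => h1 /(_ t1) h2; lra.
have Tux : T (- u) (- x).
  apply: maximally_monotone_mem => // y v /xu_mono; apply: le_trans.
  exact: sqr_ge0.
have := xu_mono _ _ Tux; rewrite subrr inner0l => xu0.
have /eqP : `|x + u| ^+ 2 = 0 by apply/eqP; rewrite eq_le xu0 sqr_ge0.
rewrite sqrf_eq0 normr_eq0 addr_eq0 => /eqP xu.
by exists x; rewrite {1}xu.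
Unshelve. all: by end_near. Qed.

(** Here [x] is the resolvent of [lam T] at [y]. Translating the argument by [y] and scaling the
    values by [lam] reduces the claim to [minty0]. *)
Lemma minty (T : H -> set H) (lam : R) (y : H) : 0 < lam ->
  maximally_monotone_op T -> exists x, T x (lam^-1 *: (y - x)).
Proof.
move=> lam0 Tmax; have lam_neq0 := gt_eqF lam0.
pose T' x := [set u | T (y + x) (lam^-1 *: u)].
have [|x Tx] := @minty0 T'; last first.
  by exists (y + x); rewrite opprD addrA subrr add0r.
split.
  move=> x u x' u' Txu Txu'; have := Tmax.1 _ _ _ _ Txu Txu'.
  rewrite -scalerBr innerZr opprD addrACA subrr add0r pmulr_rge0 //.
  by rewrite invr_gt0.
move=> N Nmono TN; apply/seteqP; split=> // -[x u] Nxu.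
rewrite /gr /T' /=; apply: (maximally_monotone_mem Tmax) => x' u' Txu'.
have : gr T' (x' - y, lam *: u').
  by rewrite /gr /T' /= addrC subrK scalerA mulVf ?scale1r ?lam_neq0.
move=> /TN Nxu'; have := Nmono _ _ _ _ Nxu Nxu'.
rewrite opprB addrA (addrC x) => h.
rewrite (_ : _ - u' = lam^-1 *: (u - lam *: u')).
  by rewrite innerZr mulr_ge0 // invr_ge0 ltW.
by rewrite scalerBr scalerA mulVf ?scale1r ?lam_neq0.
Qed.

Lemma inv_op_maximally_monotone (M : H -> set H) :
  maximally_monotone_op M -> maximally_monotone_op (inv_op M).
Proof.
move=> Mmax; split.
  by move=> x u y v Mux Mvy; rewrite innerC; exact: Mmax.1 Mux Mvy.
move=> N Nmono MN; apply/seteqP; split=> // -[x u] Nxu; rewrite /gr /inv_op /=.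
apply: (maximally_monotone_mem Mmax) => v y Myv; rewrite innerC.
by apply: (Nmono _ _ _ _ Nxu); exact: (MN (y, v) Myv).
Qed.

End minty.

(** * Real sequences and series *)

(** The upper limit is the infimum of the tail suprema, so some tail supremum lies below [b]; it
    serves as [rho]. *)
Lemma limn_esup_lt_eventually (R : realType) (u : nat -> R) (b : R) :
  (limn_esup (fun n => (u n)%:E) < b%:E)%E ->
  exists2 rho, rho < b & exists N, forall n, (N <= n)%N -> u n <= rho.
Proof.
move=> ub; pose v n := (u n)%:E.
have [_ [n _ <-] nb] : exists2 y, range (esups v) y & (y < b%:E)%E.
  apply: ereal_inf_lt; rewrite limn_esup_lim in ub.
  by rewrite -(cvg_lim _ (@cvg_esups_inf _ v)).
have un k : (n <= k)%N -> ((u k)%:E <= esups v n)%E.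
  by move=> nk; apply: ereal_sup_ubound; exists k.
move: nb un; case: (esups v n) => [r| |] //=.
  rewrite lte_fin => rb un; exists r => //; exists n => k /un.
  by rewrite lee_fin.
by move=> _ /(_ n (leqnn n)).
Qed.

(** Summability for nonnegative terms; for signed terms, as in [mean_cluster], only an upper bound
    on the partial sums is recorded. *)
Definition bounded_sums (R : realType) (f : nat -> R) (N : nat) : Prop :=
  exists M, forall n, \sum_(N <= k < n) f k <= M.

Section bounded_sums_theory.
Variable R : realType.
Implicit Types f g : nat -> R.

Lemma bounded_sums_start f N N' : bounded_sums f N -> bounded_sums f N'.
Proof.
move=> [M fM]; have M0 : 0 <= M by apply: le_trans (fM 0%N); rewrite big_geq.
have [NN'|N'N] := leqP N N'.
  exists (M + `|\sum_(N <= k < N') f k|) => n.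
  have [nN'|N'n] := leqP n N'; first by rewrite big_geq // addr_ge0.
  have := fM n; rewrite (@big_cat_nat _ _ _ N' N n) ?(ltnW N'n) //=.
  have := ler_norm (- \sum_(N <= k < N') f k); rewrite normrN; lra.
exists (M + \sum_(N' <= k < N) `|f k|) => n.
have [nN|Nn] := leqP n N; last first.
  rewrite (@big_cat_nat _ _ _ N N' n) ?(ltnW N'N) ?(ltnW Nn) //= addrC.
  by rewrite lerD // ler_sum // => k _; exact: ler_norm.
have [nN'|N'n] := leqP n N'.
  by rewrite big_geq // addr_ge0 // sumr_ge0.
rewrite (@big_cat_nat _ _ _ n N' N) ?(ltnW N'n) //=.
have : \sum_(N' <= k < n) f k <= \sum_(N' <= k < n) `|f k|.
  by rewrite ler_sum // => k _; exact: ler_norm.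
have : 0 <= \sum_(n <= k < N) `|f k| by rewrite sumr_ge0.
lra.
Qed.

Lemma bounded_sumsD f g N : bounded_sums f N -> bounded_sums g N ->
  bounded_sums (fun n => f n + g n) N.
Proof.
move=> [M fM] [M' gM]; exists (M + M') => n.
by rewrite big_split lerD // ?fM ?gM.
Qed.

Lemma bounded_sumsZ f (c : R) N : 0 <= c -> bounded_sums f N ->
  bounded_sums (fun n => c * f n) N.
Proof.
by move=> c0 [M fM]; exists (c * M) => n; rewrite -mulr_sumr ler_wpM2l.
Qed.

Lemma bounded_sums_le f g N : (forall n, (N <= n)%N -> f n <= g n) ->
  bounded_sums g N -> bounded_sums f N.
Proof.
move=> fg [M gM]; exists M => n; apply: le_trans (gM n).
by rewrite ler_sum_nat // => k /andP[Nk _]; exact: fg.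
Qed.

End bounded_sums_theory.

(** Nonnegativity puts every partial sum below the finite total, so each term is finite and [fine]
    loses nothing. *)
Lemma nneseries_fine_bounded (R : realType) (f : nat -> \bar R) :
  (forall n, (1 <= n)%N -> (0 <= f n)%E) -> (\sum_(1 <= n <oo) f n < +oo)%E ->
  (forall n, (1 <= n)%N -> f n \is a fin_num) /\
  bounded_sums (fun n => fine (f n)) 1.
Proof.
move=> f0 fsum; set S := (\sum_(1 <= n <oo) f n)%E in fsum.
have part n : (\sum_(1 <= k < n) f k <= S)%E.
  by apply: nneseries_lim_ge => k k1 _; exact: f0.
have S_fin : S \is a fin_num.
  by rewrite ge0_fin_numE // (le_trans _ (part 0%N)) // big_geq.
have f_fin n : (1 <= n)%N -> f n \is a fin_num.
  move=> n1; rewrite ge0_fin_numE ?f0 //; apply: le_lt_trans fsum.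
  apply: le_trans (part n.+1); rewrite big_nat_recr //= leeDr //.
  by rewrite big_nat_cond sume_ge0 // => k /andP[/andP[k1 _] _]; exact: f0.
split=> //; exists (fine S) => n.
rewrite -lee_fin fineK // -sumEFin; apply: le_trans (part n).
rewrite big_nat_cond [leRHS]big_nat_cond; apply: lee_sum => k.
by move=> /andP[/andP[k1 _] _]; rewrite fineK // f_fin.
Qed.

Lemma in_ell_bounded (R : realType) (p : nat) (a : nat -> R) :
  in_ell p a -> bounded_sums (fun n => `|a n| ^+ p) 1.
Proof.
by move=> /(@nneseries_fine_bounded _ (fun n => (`|a n| ^+ p)%:E)) [].
Qed.

Lemma not_in_ell1_dvg (R : realType) (a : nat -> R) :
  (forall n, (1 <= n)%N -> 0 < a n) -> ~ in_ell 1 a ->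
  \sum_(1 <= k < n.+1) a k @[n --> \oo] --> +oo.
Proof.
move=> a0 aN.
have nd : nondecreasing_seq (fun n => \sum_(1 <= k < n.+1) a k).
  apply/nondecreasing_seqP => n; rewrite [leRHS]big_nat_recr //= lerDl.
  by rewrite ltW // a0.
apply: nondecreasing_dvgn_lt => // a_cvg; apply: aN.
apply: (@le_lt_trans _ _ (limn (fun n => \sum_(1 <= k < n.+1) a k))%:E).
  apply: lime_le.
    by apply: is_cvg_nneseries => n _ _; rewrite lee_fin exprn_ge0.
  near=> n; rewrite sumEFin lee_fin.
  have -> : \sum_(1 <= k < n) `|a k| ^+ 1 = \sum_(1 <= k < n) a k.
    by apply: eq_big_nat => k /andP[k1 _]; rewrite expr1 gtr0_norm ?a0.
  apply: le_trans (nondecreasing_cvgn_le nd a_cvg n).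
  have [->|n0] := posnP n; first by rewrite !big_geq.
  by rewrite big_nat_recr //= lerDl ltW // a0.
exact: ltry.
Unshelve. all: by end_near. Qed.

Section quasi_fejer.
Variables (R : realType) (a b e : nat -> R) (N : nat).
Hypotheses (a_ge0 : forall n, 0 <= a n)
  (step : forall n, (N <= n)%N -> a n.+1 + b n <= a n + e n)
  (e_sum : bounded_sums e N).

(** Telescoping of [step]. The terms [b] may be signed, as they are in [mean_cluster]. *)
Lemma quasi_fejer_sums : bounded_sums b N.
Proof.
have [M eM] := e_sum; exists (a N + M) => n.
have M0 : 0 <= M by apply: le_trans (eM 0%N); rewrite big_geq.
have [nN|Nn] := leqP n N; first by rewrite big_geq // addr_ge0.
suff : a n + \sum_(N <= k < n) b k <= a N + \sum_(N <= k < n) e k.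
  have := eM n; have := a_ge0 n; lra.
elim: n Nn => // n IH; rewrite ltnS leq_eqVlt => /predU1P[<-|Nn].
  by rewrite !big_nat1 step.
rewrite !big_nat_recr ?(ltnW Nn) //=.
have := IH Nn; have := step (ltnW Nn); lra.
Qed.

(** The partial sums [s] of [e] converge, and [s n - a n] is eventually nondecreasing and bounded
    above; [a] is the difference of the two. *)
Lemma quasi_fejer_cvg : (forall n, (N <= n)%N -> 0 <= b n) ->
  (forall n, (N <= n)%N -> 0 <= e n) -> cvgn a.
Proof.
move=> b_ge0 e_ge0; have [M eM] := e_sum.
pose s n := \sum_(N <= k < n) e k.
have sS n : (N <= n)%N -> s n.+1 = s n + e n by move=> Nn; rewrite /s big_nat_recr.
have s_cvg : cvgn s.
  apply: (@near_nondecreasing_is_cvgn _ s M); last by near=> n; exact: eM.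
  near=> m => n mn; rewrite /s (@big_cat_nat _ _ _ m N n) //=.
    by rewrite lerDl big_nat_cond sumr_ge0 // => k /andP[/andP[mk _] _];
      apply: e_ge0; apply: leq_trans mk; near: m; exists N.
  by near: m; exists N.
have d_cvg : cvgn (fun n => s n - a n).
  apply: (@near_nondecreasing_is_cvgn _ _ M).
    near=> m => n; have Nm : (N <= m)%N by near: m; exists N.
    move=> /subnKC <-; elim: (n - m)%N => [|k]; first by rewrite addn0.
    have := @step (m + k)%N; have := @sS (m + k)%N.
    rewrite addnS (leq_trans Nm (leq_addr _ _)) => /(_ isT) -> /(_ isT).
    have := b_ge0 _ (leq_trans Nm (leq_addr k m)); lra.
  by near=> n; have := eM n; have := a_ge0 n; rewrite -/(s n); lra.
have -> : a = (fun n => s n - (s n - a n)) by apply/funext => n; lra.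
exact: is_cvgB.
Unshelve. all: by end_near. Qed.

End quasi_fejer.

(** Beyond some index the terms are within [e / 2] of [l]; the earlier block is fixed and becomes
    negligible against the divergent sum of weights. *)
Lemma weighted_cesaro (R : realType) (lam f : nat -> R) (l : R) :
  (forall n, (1 <= n)%N -> 0 < lam n) ->
  \sum_(1 <= k < n.+1) lam k @[n --> \oo] --> +oo -> f @ \oo --> l ->
  (\sum_(1 <= k < n.+1) lam k)^-1 * \sum_(1 <= k < n.+1) lam k * f k
    @[n --> \oo] --> l.
Proof.
move=> lam0 tau_dvg fl; apply/cvgrPdist_le => e e0.
have e2 : 0 < e / 2 by rewrite divr_gt0.
have [N _ fN] : \forall n \near \oo, `|l - f n| <= e / 2.
  by move/cvgrPdist_le : fl; apply.
pose S n := \sum_(1 <= k < n) lam k * `|l - f k|.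
have S_le n : (N.+1 <= n)%N ->
    S n.+1 <= S N.+1 + e / 2 * \sum_(1 <= k < n.+1) lam k.
  elim: n => // n IH; rewrite ltnS leq_eqVlt => /predU1P[<-|Nn].
    rewrite /S !(big_nat_recr N.+1) //= mulrDr.
    have : lam N.+1 * `|l - f N.+1| <= e / 2 * lam N.+1.
      by rewrite mulrC ler_wpM2r ?(ltW (lam0 _ _)) // fN /=.
    have : 0 <= e / 2 * \sum_(1 <= k < N.+1) lam k.
      rewrite mulr_ge0 ?(ltW e2) // big_nat_cond sumr_ge0 // => k.
      by move=> /andP[/andP[k1 _] _]; rewrite ltW // lam0.
    lra.
  have := IH Nn; rewrite /S !(big_nat_recr n.+1) //= -/(S n.+1) mulrDr.
  have : lam n.+1 * `|l - f n.+1| <= e / 2 * lam n.+1.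
    rewrite mulrC ler_wpM2r ?(ltW (lam0 _ _)) // fN //=.
    by rewrite (leq_trans _ (ltnW _ : (n <= n.+1)%N)) // ltnW // ltnW.
  lra.
pose tau n := \sum_(1 <= k < n.+1) lam k.
near=> n; rewrite -/(tau n).
have tau0 : 0 < tau n by near: n; exact: cvgry_gt.
have -> : l - (tau n)^-1 * \sum_(1 <= k < n.+1) lam k * f k =
    (tau n)^-1 * \sum_(1 <= k < n.+1) lam k * (l - f k).
  rewrite [in RHS](eq_bigr (fun k => lam k * l - lam k * f k)) => [|k _].
    by rewrite sumrB -mulr_suml -/(tau n) mulrBr mulrA mulVf ?mul1r ?gt_eqF.
  by rewrite mulrBr.
rewrite normrM gtr0_norm ?invr_gt0 // ler_pdivrMl //.
apply: (@le_trans _ _ (S n.+1)).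
  apply: (le_trans (ler_norm_sum _ _ _)); rewrite /S ler_sum_nat // => k.
  by move=> /andP[k1 _]; rewrite normrM gtr0_norm ?lam0.
have : S N.+1 <= e / 2 * tau n.
  by rewrite -ler_pdivrMl // mulrC; near: n; exact: cvgry_ge.
have : S n.+1 <= S N.+1 + e / 2 * tau n by apply: S_le; near: n; exists N.+1.
lra.
Unshelve. all: by end_near. Qed.

Lemma cvg_invM_dvg (R : realType) (tau : nat -> R) (M : R) :
  tau @ \oo --> +oo -> (tau n)^-1 * M @[n --> \oo] --> 0.
Proof.
move=> tau_dvg; rewrite -[X in _ --> X](mul0r M); apply: cvgMl.
apply: (gtr0_cvgV0 (f := tau) _).2 => //.
by near=> n; near: n; exact: cvgry_gt.
Unshelve. all: by end_near. Qed.

(** The weighted means of [a] tend to the limit of [a], yet are at most [M] over the divergent sum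
    of weights. *)
Lemma bounded_weighted_sums_cvg0 (R : realType) (lam a : nat -> R) :
  (forall n, (1 <= n)%N -> 0 < lam n) ->
  \sum_(1 <= k < n.+1) lam k @[n --> \oo] --> +oo ->
  (forall n, 0 <= a n) -> cvgn a -> bounded_sums (fun n => lam n * a n) 1 ->
  a @ \oo --> 0.
Proof.
move=> lam0 tau_dvg a0 a_cvg [M aM].
suff <- : limn a = 0 by [].
apply/eqP; rewrite eq_le; apply/andP; split; last first.
  by apply: limr_ge => //; near=> n.
apply: (ler_cvg_to (weighted_cesaro lam0 tau_dvg a_cvg) (cvg_invM_dvg M tau_dvg)).
near=> n; have tau0 : 0 < \sum_(1 <= k < n.+1) lam k.
  by near: n; exact: cvgry_gt.
by rewrite ler_wpM2l ?invr_ge0 // ltW.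
Unshelve. all: by end_near. Qed.

(** * Weak compactness and the Opial-Passty lemma *)

(** If convergence failed at [V], an ultrafilter refining [F] within the complement of the preimage
    of [V] would contradict the premise. Ultrafilters play the role of subsequences below. *)
Lemma cvg_ultraP (T : Type) (U : topologicalType) (F : set_system T)
    (f : T -> U) (l : U) : ProperFilter F ->
  (forall G : set_system T, UltraFilter G -> F `<=` G -> f @ G --> l) ->
  f @ F --> l.
Proof.
move=> FF fG V lV; apply: contrapT; rewrite -[nbhs _ V]/(F (f @^-1` V)) => FV.
pose D := ~` (f @^-1` V).
have Fsub : F `<=` within D F by move=> A FA; apply: filterS FA.
have wF : ProperFilter (within D F).
  split; last exact: within_filter.
  move=> w0; apply: FV; have {}w0 : F [set t | D t -> False] := w0.
  apply: filterS w0 => t Dt; apply: contrapT => nV; exact: Dt.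
have [G [GU wG]] := ultraFilterLemma wF.
have GD : G D by apply: wG; exact: withinT.
have GV : G (f @^-1` V) := fG G GU (subset_trans Fsub wG) V lV.
by have [t []] := filter_ex (filterI GV GD).
Qed.

(** By compactness of [[- M, M]] the image filter has a cluster point, and an ultrafilter converges
    to its cluster points. *)
Lemma ultra_bounded_cvg (T : Type) (R : realType) (F : set_system T)
    (f : T -> R) (M : R) : UltraFilter F -> (forall t, `|f t| <= M) ->
  cvg (f @ F).
Proof.
move=> FU fM.
have [|l [_ lF]] := @segment_compact R (- M) M (f @ F).
- have : F (f @^-1` `[- M, M]); last by [].
  by near=> t; rewrite /= in_itv /= -ler_norml.

apply/cvg_ex; exists l => V lV.
have [//|nV] := in_ultra_setVsetC (f @^-1` V) FU.
by have [t []] := lF (~` V) V nV lV.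
Unshelve. all: by end_near. Qed.

Section weak_compactness.
Variables (R : realType) (H : hilbertType R).

(** The limits of [inner (u t) y] along [F] form a bounded linear functional of [y]; its Riesz
    representative is the weak limit. *)
Lemma ultra_weak_cvg (F : set_system nat) (u : nat -> H) (M : R) :
  UltraFilter F -> (forall t, `|u t| <= M) ->
  exists z, forall y, inner (u t) y @[t --> F] --> inner z y.
Proof.
move=> FU uM; have FF : ProperFilter F by exact: ultra_proper.
pose f y := lim (inner (u t) y @[t --> F]).
have f_cvg y : inner (u t) y @[t --> F] --> f y.
  apply: (@ultra_bounded_cvg _ _ _ _ (M * `|y|)) => t.
  by rewrite (le_trans (ler_norm_inner _ _))// ler_wpM2r.
have [|||z fz] := @riesz_representation R H f.
- move=> y y'; apply: cvg_lim => //; under eq_fun do rewrite innerDr.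
  exact: cvgD.
- move=> a y; apply: cvg_lim => //; under eq_fun do rewrite innerZr.
  exact: cvgMr.
- exists M => y.
  apply: (@ler_cvg_to _ F _ _ (fun t => `|inner (u t) y|) (fun=> M * `|y|)).
  + exact: cvg_norm.
  + exact: cvg_cst.
  + by near=> t; rewrite (le_trans (ler_norm_inner _ _))// ler_wpM2r.
by exists z => y; rewrite (innerC z) -fz.
Unshelve. all: by end_near. Qed.

Lemma inner_weighted_mean (lam : nat -> R) (x : nat -> H) n y :
  inner (weighted_mean lam x n) y =
  (\sum_(1 <= k < n.+1) lam k)^-1 * \sum_(1 <= k < n.+1) lam k * inner (x k) y.
Proof.
rewrite /weighted_mean innerZl inner_suml; congr (_ * _).
by apply: eq_bigr => k _; rewrite innerZl.
Qed.

Lemma ler_norm_weighted_mean (lam : nat -> R) (x : nat -> H) (M : R) n :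
  (forall n, (1 <= n)%N -> 0 < lam n) -> (forall n, `|x n| <= M) ->
  `|weighted_mean lam x n| <= M.
Proof.
move=> lam0 xM; rewrite /weighted_mean.
have [->|n0] := posnP n.
  by rewrite !big_geq // scaler0 normr0 (le_trans _ (xM 0%N)).
have tau0 : 0 < \sum_(1 <= k < n.+1) lam k.
  rewrite big_nat_recr //= ltr_wpDl ?lam0 // big_nat_cond sumr_ge0 // => k.
  by move=> /andP[/andP[k1 _] _]; rewrite ltW // lam0.
rewrite normrZ gtr0_norm ?invr_gt0 // ler_pdivrMl // mulr_suml.
apply: (le_trans (ler_norm_sum _ _ _)); rewrite ler_sum_nat // => k.
by move=> /andP[k1 _]; rewrite normrZ gtr0_norm ?lam0 // ler_wpM2l // ltW ?lam0.
Qed.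

End weak_compactness.

(* Componentwise, since the norm of [H * G] is the max norm, which is not
   Hilbertian. *)
Lemma opial_passty (R : realType) (H G : hilbertType R) (lam : nat -> R)
    (x : nat -> H) (v : nat -> G) (Z : H -> G -> Prop) :
  (forall n, (1 <= n)%N -> 0 < lam n) ->
  \sum_(1 <= k < n.+1) lam k @[n --> \oo] --> +oo ->
  (exists u w, Z u w) ->
  (forall u w, Z u w -> cvgn (fun n => `|x n - u| ^+ 2 + `|v n - w| ^+ 2)) ->
  (forall (F : set_system nat) u w, ProperFilter F -> \oo `<=` F ->
    (forall y, inner (weighted_mean lam x n) y @[n --> F] --> inner u y) ->
    (forall y, inner (weighted_mean lam v n) y @[n --> F] --> inner w y) ->
    Z u w) ->
  exists u w, Z u w /\ weakly_cvg (weighted_mean lam x) u.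
Proof.
move=> lam0 tau_dvg [u0 [w0 Z0]] Z_cvg Z_cluster.
have [M xM vM] : exists2 M, forall n, `|x n| <= M & forall n, `|v n| <= M.
  have [r [_ /(_ (r + 1)) rP]] := cvg_seq_bounded (Z_cvg _ _ Z0).
  have sqr_bound (a b : R) : a ^+ 2 + b ^+ 2 <= r + 1 -> 0 <= a -> 0 <= b ->
      a <= r + 2 /\ b <= r + 2.
    by move=> abr a0 b0; split; nra.
  have xv_bound n : `|x n - u0| <= r + 2 /\ `|v n - w0| <= r + 2.
    apply: sqr_bound => //; apply: (le_trans (ler_norm _)).
    by apply: rP; rewrite ?ltrDl.
  exists (r + 2 + `|u0| + `|w0|) => n; have [r1 r2] := xv_bound n.
    rewrite -[x n](subrK u0); apply: (le_trans (ler_normD _ _)).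
    by have := normr_ge0 w0; lra.
  rewrite -[v n](subrK w0); apply: (le_trans (ler_normD _ _)).
  by have := normr_ge0 u0; lra.
have cluster (F : set_system nat) : UltraFilter F -> \oo `<=` F ->
    exists u w, [/\ Z u w,
    forall y, inner (weighted_mean lam x n) y @[n --> F] --> inner u y &
    forall y, inner (weighted_mean lam v n) y @[n --> F] --> inner w y].
  move=> FU oF.
  have [u uP] := @ultra_weak_cvg _ _ F _ _ FU (fun n =>
    ler_norm_weighted_mean n lam0 xM).
  have [w wP] := @ultra_weak_cvg _ _ F _ _ FU (fun n =>
    ler_norm_weighted_mean n lam0 vM).
  by exists u, w; split=> //; apply: (Z_cluster F) => //; exact: ultra_proper.
(* Opial's argument: the difference of the squared distances to two points of [Z] is affine in the
   iterates, so [c] converges, and so do its weighted means. Both cluster points then have the same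
   inner product with their difference. *)
have uniq (F F' : set_system nat) u w u' w' :
    UltraFilter F -> \oo `<=` F -> UltraFilter F' -> \oo `<=` F' ->
    Z u w -> Z u' w' ->
    (forall y, inner (weighted_mean lam x n) y @[n --> F] --> inner u y) ->
    (forall y, inner (weighted_mean lam v n) y @[n --> F] --> inner w y) ->
    (forall y, inner (weighted_mean lam x n) y @[n --> F'] --> inner u' y) ->
    (forall y, inner (weighted_mean lam v n) y @[n --> F'] --> inner w' y) ->
    u = u'.
  move=> FU oF FU' oF' Zuw Zuw' xF vF xF' vF'.
  have FF : ProperFilter F by exact: ultra_proper.
  have FF' : ProperFilter F' by exact: ultra_proper.
  pose c n := inner (x n) (u - u') + inner (v n) (w - w').
  have c_cvg : cvgn c.
    pose a u w n := `|x n - u| ^+ 2 + `|v n - w| ^+ 2.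
    have -> : c = (fun n => 2^-1 * (a u' w' n - a u w n
        + (`|u| ^+ 2 + `|w| ^+ 2 - `|u'| ^+ 2 - `|w'| ^+ 2))).
      apply/funext => n; rewrite /c /a !sqr_normB !innerBr; lra.
    apply: is_cvgMr; apply: is_cvgD; last exact: is_cvg_cst.
    by apply: is_cvgB; exact: Z_cvg.
  have mean_cvg : inner (weighted_mean lam x n) (u - u') +
      inner (weighted_mean lam v n) (w - w') @[n --> \oo] --> limn c.
    rewrite (_ : (fun n => _ + _) = (fun n => (\sum_(1 <= k < n.+1) lam k)^-1 *
       \sum_(1 <= k < n.+1) lam k * c k)); first exact: weighted_cesaro.
    apply/funext => n; rewrite !inner_weighted_mean -mulrDr -big_split.
    by congr (_ * _); apply: eq_bigr => k _; rewrite /c mulrDr.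
  have lim_mean (F0 : set_system nat) u1 w1 : ProperFilter F0 -> \oo `<=` F0 ->
      (forall y, inner (weighted_mean lam x n) y @[n --> F0] --> inner u1 y) ->
      (forall y, inner (weighted_mean lam v n) y @[n --> F0] --> inner w1 y) ->
      inner u1 (u - u') + inner w1 (w - w') = limn c.
    move=> F0P oF0 xF0 vF0; rewrite -(cvg_lim (@Rhausdorff R) (cvgD (xF0 _) (vF0 _))).
    by apply: cvg_lim => // A /mean_cvg; exact: oF0.
  have := lim_mean F u w FF oF xF vF; have := lim_mean F' u' w' FF' oF' xF' vF'.
  move=> e1 e2.
  have : `|u - u'| ^+ 2 + `|w - w'| ^+ 2 = 0.
    rewrite -!inner_norm innerBl (innerBl w); lra.
  move=> /eqP; rewrite paddr_eq0 ?sqr_ge0 // sqrf_eq0 normr_eq0 subr_eq0.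
  by move=> /andP[/eqP].
(* One ultrafilter names the limit; by [uniq] all others share it. *)
have [F [FU oF]] := ultraFilterLemma (ltac:(exact _) : ProperFilter \oo).
have [u [w [Zuw xF vF]]] := cluster F FU oF.
exists u, w; split=> // y; apply: cvg_ultraP => F' FU' oF'.
have [u' [w' [Zuw' xF' vF']]] := cluster F' FU' oF'.
by rewrite (uniq F F' u w u' w').
Qed.

(** * The forward-backward-forward step *)

Lemma lipschitz_dist (R : realType) (V W : normedModType R) (k : R) (f : V -> W)
    (x y : V) : k.-lipschitz f -> `|f x - f y| <= k * `|x - y|.
Proof. by move=> /(_ (x, y)); apply. Qed.

(** Testing a vector identity against an arbitrary vector turns it into a scalar identity for
    [ring]. *)
Ltac inner_ring := apply: inner_injr => ?;
  rewrite !(innerDr, innerNr, innerZr, inner0r); ring.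

Section product_inclusion.
Variables (R : realType) (H G : hilbertType R).
Variables (K : {linear H -> G}) (K_cont : continuous K).

(* The skew terms [K^*] and [- K] cancel, so the resolvent point of
   [(T, S)] with a small step at [(z, y)] coincides with [(z, y)]. *)
Lemma maximally_monotone_skew_sum (T : H -> set H) (S : G -> set G)
    (D : H -> H) (L : R) (z : H) (y : G) :
  maximally_monotone_op T -> maximally_monotone_op S ->
  0 <= L -> L.-lipschitz D ->
  (forall u t w s, T u t -> S w s ->
    0 <= inner (u - z) (t + D u + adjoint K w) + inner (w - y) (s - K u)) ->
  T z (- (D z + adjoint K y)) /\ S y (K z).
Proof.
move=> Tmax Smax L0 D_lip zy.
(* With step [1 / (L + 1)] the resolvents produce a term of weight [L + 1] in the squared distance,
   which absorbs the Lipschitz error of weight [L]. *)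
have L1 : 0 < L + 1 by rewrite ltr_wpDl.
have lam0 : 0 < (L + 1)^-1 by rewrite invr_gt0.
have [u] := minty (z - (L + 1)^-1 *: (D z + adjoint K y)) lam0 Tmax.
have [w] := minty (y + (L + 1)^-1 *: K z) lam0 Smax.
rewrite invrK.
have -> : (L + 1) *: (y + (L + 1)^-1 *: K z - w) = (L + 1) *: (y - w) + K z.
  by rewrite addrAC scalerDr scalerA divff ?scale1r ?gt_eqF.
have -> : (L + 1) *: (z - (L + 1)^-1 *: (D z + adjoint K y) - u) =
    (L + 1) *: (z - u) - (D z + adjoint K y).
  by rewrite addrAC scalerBr scalerA divff ?scale1r ?gt_eqF.
move=> Sw Tu; have := zy _ _ _ _ Tu Sw.
have Duz : inner (u - z) (D u - D z) <= L * `|u - z| ^+ 2.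
  apply: (le_trans (ler_norm _)); apply: (le_trans (ler_norm_inner _ _)).
  rewrite expr2 mulrCA ler_wpM2l //; exact: lipschitz_dist.
have skew : inner (u - z) (adjoint K w - adjoint K y) = inner (w - y) (K u - K z).
  by rewrite -adjointB // -inner_adjoint // innerC (raddfB K).
move=> h; have : `|u - z| ^+ 2 + `|w - y| ^+ 2 <= 0.
  have LW : 0 <= L * `|w - y| ^+ 2 by rewrite mulr_ge0 ?sqr_ge0.
  move: Duz skew h LW; rewrite -!inner_norm.
  rewrite !(innerDl, innerDr, innerNl, innerNr, innerZr) (innerC z u) (innerC y w).
  lra.
rewrite le_eqVlt ltNge addr_ge0 ?sqr_ge0 // orbF.
rewrite paddr_eq0 ?sqr_ge0 // !sqrf_eq0 !normr_eq0 !subr_eq0.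
move=> /andP[/eqP uz /eqP wy]; move: Sw Tu; rewrite uz wy.
by rewrite !subrr !scaler0 !add0r.
Qed.

End product_inclusion.

Lemma three_point (R : realType) (H : hilbertType R) (x x' p u : H) :
  `|x' - u| ^+ 2 = `|x - u| ^+ 2 - `|x - p| ^+ 2 + `|x' - p| ^+ 2
    - 2 * inner (p - u) (x - x').
Proof.
rewrite !sqr_normB innerBl !innerBr.
rewrite (innerC p x) (innerC u x) (innerC p x') (innerC u x'); lra.
Qed.

Section forward_backward_forward_step.
Variables (R : realType) (H G : hilbertType R).
Variables (K : {linear H -> G}) (K_cont : continuous K).
Variables (D B : H -> H) (eta mu : R) (eta_gt0 : 0 < eta) (mu_gt0 : 0 < mu).
Hypotheses (D_mono : monotone_op (fun_op D)) (D_lip : (eta^-1).-lipschitz D)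
  (B_lip : (mu^-1).-lipschitz B).
Variables (lam bet rho : R) (lam_gt0 : 0 < lam) (bet_gt0 : 0 < bet).
Hypothesis rho_ge : lam * bet / mu
  + lam * Num.sqrt (2 * (1 / eta ^+ 2 + opnorm K ^+ 2)) <= rho.
Variables (x p x' a : H) (v q v' s : G).
Hypotheses
  (p_def : x - lam *: (D x + adjoint K v) - (lam * bet) *: B x = p + lam *: a)
  (q_def : v + lam *: K x = q + lam *: s)
  (x_def : x' = (lam * bet) *: (B x - B p) + lam *: (D x - D p)
                + lam *: adjoint K (v - q) + p)
  (v_def : v' = lam *: K (p - x) + q).

(** Minkowski's inequality in the product space: the [B] part of the correction has constant
    [lam * bet / mu], the joint part of [D] and [K] has constant [lam * S]. *)
Lemma correction_contraction :
  `|x' - p| ^+ 2 + `|v' - q| ^+ 2 <= rho ^+ 2 * (`|x - p| ^+ 2 + `|v - q| ^+ 2).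
Proof.
have := rho_ge; set k := opnorm K; set S := Num.sqrt _ => le_rho.
have k0 : 0 <= k by exact: opnorm_ge0.
have S2 : S ^+ 2 = 2 * ((eta^-1) ^+ 2 + k ^+ 2).
  by rewrite sqr_sqrtr ?mulr_ge0 ?addr_ge0 ?divr_ge0 ?sqr_ge0 // exprVn mul1r.
have S0 : 0 <= S by exact: sqrtr_ge0.
pose X := `|x - p|; pose V := `|v - q|; pose n := Num.sqrt (X ^+ 2 + V ^+ 2).
have X0 : 0 <= X := normr_ge0 _; have V0 : 0 <= V := normr_ge0 _.
have n2 : n ^+ 2 = X ^+ 2 + V ^+ 2 by rewrite sqr_sqrtr // addr_ge0 ?sqr_ge0.
have n0 : 0 <= n by exact: sqrtr_ge0.
have Xn : X <= n by rewrite -ler_sqr ?nnegrE // n2 lerDl sqr_ge0.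
pose d := `|D x - D p + adjoint K (v - q)|.
have d_le : d <= eta^-1 * X + k * V.
  apply: (le_trans (ler_normD _ _)); rewrite lerD //; first exact: lipschitz_dist.
  exact: ler_norm_adjoint.
have eta0 : 0 < eta^-1 by rewrite invr_gt0.
have d0 : 0 <= d := normr_ge0 _.
(* The factor 2 in [S] comes from bounding the square of a sum by twice the sum of squares. *)
have dS : d ^+ 2 + (k * X) ^+ 2 <= (S * n) ^+ 2.
  rewrite [(S * n) ^+ 2]exprMn S2 n2.
  have : d ^+ 2 <= (eta^-1 * X + k * V) ^+ 2.
    by rewrite ler_sqr ?nnegrE ?addr_ge0 ?mulr_ge0 // ltW.
  have := sqr_ge0 (eta^-1 * X - k * V); have := sqr_ge0 (k * X).
  have := sqr_ge0 (eta^-1 * V); nra.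
have dSn : d <= S * n.
  rewrite -ler_sqr ?nnegrE ?mulr_ge0 //; have := sqr_ge0 (k * X); lra.
have bX : `|B x - B p| <= mu^-1 * n.
  apply: (le_trans (lipschitz_dist _ _ B_lip)).
  by rewrite ler_wpM2l // invr_ge0 ltW.
have x'p : `|x' - p| <= lam * bet * (mu^-1 * n) + lam * d.
  rewrite x_def addrK -addrA -scalerDr.
  apply: (le_trans (ler_normD _ _)); rewrite !normrZ !gtr0_norm ?mulr_gt0 //.
  by rewrite lerD // ler_wpM2l // ltW // mulr_gt0.
have v'q : `|v' - q| <= lam * (k * X).
  rewrite v_def addrK normrZ gtr0_norm // ler_wpM2l ?(ltW lam_gt0) //.
  by rewrite /X distrC; exact: ler_opnorm.
have c0 : 0 <= lam * bet * (mu^-1 * n).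
  by rewrite !mulr_ge0 ?invr_ge0 // ltW.
have lS : 0 <= lam * bet / mu + lam * S.
  by rewrite addr_ge0 ?mulr_ge0 ?invr_ge0 // ltW.
rewrite -n2; apply: (@le_trans _ _ ((lam * bet / mu + lam * S) ^+ 2 * n ^+ 2)).
  apply: (@le_trans _ _ ((lam * bet * (mu^-1 * n) + lam * d) ^+ 2
    + (lam * (k * X)) ^+ 2)).
    have c1 : 0 <= lam * (k * X) by rewrite !mulr_ge0 // ltW.
    have c2 : 0 <= lam * d by rewrite mulr_ge0 // ltW.
    by apply: lerD; rewrite ler_sqr ?nnegrE ?addr_ge0.
  (* Only the cross term uses [dSn]; the squares of [d] and [k * X] are bounded jointly by [dS]. *)
  have -> : (lam * bet / mu + lam * S) ^+ 2 * n ^+ 2 =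
    (lam * bet * (mu^-1 * n)) ^+ 2 + 2 * (lam * bet * (mu^-1 * n)) * (lam * (S * n))
    + lam ^+ 2 * (S * n) ^+ 2 by ring.
  have h1 := ler_wpM2l (sqr_ge0 lam) dS.
  have h2 := ler_wpM2l c0 (ler_wpM2l (ltW lam_gt0) dSn).
  move: h1 h2; rewrite !sqrrD !exprMn; lra.
by rewrite ler_wpM2r ?sqr_ge0 // ler_sqr ?nnegrE // (le_trans lS).
Qed.

(** The three-point identity in both components, with [correction_contraction] for the correction
    error. Monotonicity of [D] and skewness of the [K] terms move the remaining evaluations from
    [(p, q)] to [(u, w)]. *)
Lemma fbf_step (u t c : H) (w r : G) :
  `|x' - u| ^+ 2 + `|v' - w| ^+ 2
    + (1 - rho ^+ 2) * (`|x - p| ^+ 2 + `|v - q| ^+ 2)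
    + 2 * lam * (inner (p - u) (a - t) + inner (q - w) (s - r))
  <= `|x - u| ^+ 2 + `|v - w| ^+ 2
    + 2 * (lam * bet * (inner (u - p) (B p) + inner (p - u) (bet^-1 *: c)))
    + 2 * lam * (inner (t + c + D u + adjoint K w) (u - p)
                 + inner (r - K u) (w - q)).
Proof.
(* The correction cancels the forward evaluations at [(x, v)]: each step is [lam] times operator
   values at [(p, q)]. *)
have xx' : x - x' = lam *: (a + D p + adjoint K q + bet *: B p).
  have -> : x = p + lam *: a + lam *: (D x + adjoint K v) + (lam * bet) *: B x.
    by rewrite -p_def; inner_ring.
  by rewrite x_def adjointB //; inner_ring.
have vv' : v - v' = lam *: (s - K p).
  have -> : v = q + lam *: s - lam *: K x by rewrite -q_def addrK.
  by rewrite v_def linearB /=; inner_ring.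
have := correction_contraction.
have skew : inner (p - u) (adjoint K q - adjoint K w) = inner (q - w) (K p - K u).
  by rewrite -adjointB // -inner_adjoint // innerC (raddfB K).
have D_mon : 0 <= inner (p - u) (D p - D u) by exact: D_mono.
have lamD := mulr_ge0 (ltW lam_gt0) D_mon.
have lam_skew := congr1 (fun m => lam * m) skew.
have betK : lam * bet * (inner (u - p) (B p) + inner (p - u) (bet^-1 *: c)) =
    lam * bet * inner (u - p) (B p) + lam * inner (p - u) c.
  by rewrite innerZr mulrDr [in X in _ + X]mulrA mulfK ?gt_eqF.
rewrite (three_point x x' p u) (three_point v v' q w) xx' vv'.
rewrite (innerC (_ + adjoint K w)) (innerC (r - K u)).
rewrite betK; move: lamD lam_skew.
rewrite !(innerDl, innerDr, innerNl, innerNr, innerZr); lra.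
Qed.

End forward_backward_forward_step.

(** * Convergence of the penalty scheme *)

Section penalty.
Variables (R : realType) (H : hilbertType R) (B : H -> H) (C : set H).

(** A normal vector at [u] is a functional whose maximum over [C] is attained at [u]. *)
Lemma support_fun_normal_cone (u c : H) (a : R) : 0 <= a -> normal_cone C u c ->
  support_fun C (a *: c) = (inner u (a *: c))%:E.
Proof.
move=> a0 [Cu cu]; apply/eqP; rewrite eq_le; apply/andP; split.
  apply: ge_ereal_sup => _ [y Cy <-]; rewrite lee_fin !innerZr ler_wpM2l //.
  by have := cu y Cy; rewrite innerC innerBl subr_le0.
by apply: ereal_sup_ubound; exists u.
Qed.

(** With [a = lambda n * beta n] and [b = (beta n)^-1], this unfolds to the general term of the
    series in the summability hypothesis. *)
Definition penalty (a b : R) (c : H) : \bar R :=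
  (a%:E * (ereal_sup [set fitzpatrick (fun_op B) u (b *: c) | u in C]
           - support_fun C (b *: c)))%E.

(** Keep the point [u] in the supremum over [C] and the pair [(y, B y)] in the Fitzpatrick
    function. *)
Lemma penalty_ge (a b : R) (u c y : H) : 0 <= a -> 0 <= b ->
  normal_cone C u c ->
  ((a * (inner (u - y) (B y) + inner (y - u) (b *: c)))%:E <= penalty a b c)%E.
Proof.
move=> a0 b0 uc; rewrite /penalty (support_fun_normal_cone b0 uc).
rewrite EFinM lee_wpmul2l ?lee_fin // leeBrDr // -EFinD.
apply: (@le_trans _ _ (fitzpatrick (fun_op B) u (b *: c))); last first.
  by apply: ereal_sup_ubound; exists u => //; case: uc.
apply: ereal_sup_ubound; exists (y, B y) => //=.
by congr (_%:E); rewrite !innerBl; ring.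
Qed.

(** The choice [y = u] in [penalty_ge] gives the lower bound 0, since [B u = 0]. *)
Lemma penalty_ge0 (a b : R) (u c : H) : C `<=` zer (fun_op B) ->
  0 <= a -> 0 <= b -> normal_cone C u c -> (0 <= penalty a b c)%E.
Proof.
move=> CB a0 b0 uc; apply: le_trans (penalty_ge u a0 b0 uc).
by have <- : 0 = B u := CB _ uc.1; rewrite inner0r subrr inner0l addr0 mulr0.
Qed.

End penalty.

Section convergence.
Variables (R : realType) (H G : hilbertType R)
    (A1 : H -> set H) (A2 : G -> set G)
    (A1_max : maximally_monotone_op A1) (A2_max : maximally_monotone_op A2)
    (K : {linear H -> G}) (K_cont : continuous K)
    (D : H -> H) (eta : R) (eta_gt0 : 0 < eta)
    (D_mono : monotone_op (fun_op D)) (D_lip : (eta^-1).-lipschitz D)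
    (B : H -> H) (mu : R) (mu_gt0 : 0 < mu)
    (B_lip : (mu^-1).-lipschitz B)
    (C : set H) (C_def : C = zer (fun_op B))
    (lambda beta : nat -> R)
    (lambda_gt0 : forall n, (1 <= n)%N -> 0 < lambda n)
    (beta_gt0 : forall n, (1 <= n)%N -> 0 < beta n)
    (x p : nat -> H) (v q : nat -> G)
    (p_def : forall n, (1 <= n)%N ->
       resolvent (scale_op (lambda n) A1)
         (x n - lambda n *: (D (x n) + adjoint K (v n))
              - (lambda n * beta n) *: B (x n)) (p n))
    (q_def : forall n, (1 <= n)%N ->
       resolvent (scale_op (lambda n) (inv_op A2))
         (v n + lambda n *: K (x n)) (q n))
    (x_rec : forall n, (1 <= n)%N ->
       x n.+1 = (lambda n * beta n) *: (B (x n) - B (p n))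
                + lambda n *: (D (x n) - D (p n))
                + lambda n *: adjoint K (v n - q n) + p n)
    (v_rec : forall n, (1 <= n)%N ->
       v n.+1 = lambda n *: K (p n - x n) + q n)
    (h1_max : maximally_monotone_op (add_op A1 (normal_cone C)))
    (h1_zer : zer (inclusion_op A1 A2 K D C) !=set0)
    (h2 : forall w : H, ran (normal_cone C) w ->
       (\sum_(1 <= n <oo) penalty B C (lambda n * beta n) (beta n)^-1 w < +oo)%E)
    (h3_l2 : in_ell 2 lambda) (h3_l1 : ~ in_ell 1 lambda)
    (h4 : (limn_esup (fun n =>
             (lambda n * beta n / mu
              + lambda n * Num.sqrt (2 * (1 / eta ^+ 2 + opnorm K ^+ 2)))%:E)
           < 1)%E).

Lemma penalty_summable u c : normal_cone C u c ->
  exists e : nat -> R, [/\ forall n, (1 <= n)%N -> 0 <= e n, bounded_sums e 1 &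
    forall n y, (1 <= n)%N -> lambda n * beta n *
      (inner (u - y) (B y) + inner (y - u) ((beta n)^-1 *: c)) <= e n].
Proof.
move=> uc.
have lb0 n : (1 <= n)%N -> 0 <= lambda n * beta n /\ 0 <= (beta n)^-1.
  by move=> n1; rewrite mulr_ge0 ?invr_ge0 ?ltW ?lambda_gt0 ?beta_gt0.
have pen0 n : (1 <= n)%N ->
    (0 <= penalty B C (lambda n * beta n) (beta n)^-1 c)%E.
  by move=> /lb0[l0 b0]; apply: (@penalty_ge0 _ _ _ _ _ _ u) => //; rewrite C_def.
have [|pen_fin pen_sum] := nneseries_fine_bounded pen0.
  by apply: h2; exists u.
exists (fun n => fine (penalty B C (lambda n * beta n) (beta n)^-1 c)); split=> //.
  by move=> n n1; rewrite fine_ge0 // pen0.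
move=> n y n1; have [l0 b0] := lb0 n n1.
rewrite -lee_fin fineK ?pen_fin //; exact: penalty_ge.
Qed.

(** The moduli [g1] and [g2] are 0 for the ergodic claim and positive for the strong one. The vector
    [c] is kept apart from [t] because the penalty must be compared with it. *)
Lemma fejer_inequality (u t c : H) (w r : G) (g1 g2 : R) :
  normal_cone C u c ->
  (forall y b, A1 y b -> g1 * `|y - u| ^+ 2 <= inner (y - u) (b - t)) ->
  (forall y b, inv_op A2 y b -> g2 * `|y - w| ^+ 2 <= inner (y - w) (b - r)) ->
  exists e delta N, [/\ 0 < delta, (1 <= N)%N,
    forall n, (N <= n)%N -> 0 <= e n, bounded_sums e N & forall n, (N <= n)%N ->
    `|x n.+1 - u| ^+ 2 + `|v n.+1 - w| ^+ 2
    + (delta * (`|x n - p n| ^+ 2 + `|v n - q n| ^+ 2)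
       + 2 * lambda n * (g1 * `|p n - u| ^+ 2 + g2 * `|q n - w| ^+ 2))
    <= `|x n - u| ^+ 2 + `|v n - w| ^+ 2
    + (e n + 2 * lambda n * (inner (t + c + D u + adjoint K w) (u - p n)
                          + inner (r - K u) (w - q n)))].
Proof.
move=> uc A1g A2g; have [e [e0 e_sum e_ge]] := penalty_summable uc.
have [rho' rho1 [N0 rhoP]] := limn_esup_lt_eventually h4.
(* Nonnegativity is what makes [rho < 1] give a positive [1 - rho ^+ 2]. *)
pose rho := Num.max rho' 0.
have rho0 : 0 <= rho by rewrite le_max lexx orbT.
have {}rho1 : rho < 1 by rewrite gt_max rho1 /=.
exists (fun n => 2 * e n), (1 - rho ^+ 2), (maxn 1 N0); split.
- by rewrite subr_gt0 expr_lt1.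
- exact: leq_maxl.
- by move=> n; rewrite geq_max => /andP[n1 _]; rewrite mulr_ge0 // e0.
- by apply: bounded_sumsZ => //; exact: bounded_sums_start e_sum.
move=> n; rewrite geq_max => /andP[n1 nN].
have [lam0 bet0] := (lambda_gt0 n1, beta_gt0 n1).
(* Unfolding the resolvent exposes [a] in [A1 (p n)] with [p n + lambda n *: a] equal to its
   argument; likewise [s] for [q n]. *)
have [_ /= -> [_ [a A1a <-] /esym pE]] := p_def n1.
have [_ /= -> [_ [s A2s <-] /esym qE]] := q_def n1.
have rho_ge : lambda n * beta n / mu
    + lambda n * Num.sqrt (2 * (1 / eta ^+ 2 + opnorm K ^+ 2)) <= rho.
  by rewrite le_max rhoP.
have := fbf_step K_cont eta_gt0 mu_gt0 D_mono D_lip B_lip lam0 bet0 rho_ge pE qE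
  (x_rec n1) (v_rec n1) u t c w r.
have := e_ge n (p n) n1; have := A1g _ _ A1a; have := A2g _ _ A2s.
have lam2 : 0 <= 2 * lambda n by rewrite mulr_ge0 // ltW.
move=> /(ler_wpM2l lam2) h_2 /(ler_wpM2l lam2) h_1; lra.
Qed.

(** Primal-dual form of the inclusion: the dual variable [w] is the element of [A2 (K u)] that it
    selects. *)
Let Z (u : H) (w : G) := exists t c, [/\ A1 u t, normal_cone C u c,
  inv_op A2 w (K u) & t + c + D u + adjoint K w = 0].

Lemma zer_inclusionP u : zer (inclusion_op A1 A2 K D C) u <-> exists w, Z u w.
Proof.
split.
  move=> [_ [_ [t A1t [_ [w A2w <-] <-]] [_ /= -> <-]] [c uc]] /= E.
  exists w, t, c; split=> //; rewrite -E; inner_ring.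
move=> [w [t [c [A1t uc A2w E]]]].
exists (t + adjoint K w + D u); last by exists c => //; rewrite -E; inner_ring.
exists (t + adjoint K w); last by exists (D u).
by exists t => //; exists (adjoint K w) => //; exists w.
Qed.

(** Monotonicity as modulus 0, in the form [fejer_inequality] takes. *)
Lemma A1_monotone u t : A1 u t ->
  forall y b, A1 y b -> 0 * `|y - u| ^+ 2 <= inner (y - u) (b - t).
Proof. by move=> A1t y b A1b; rewrite mul0r; exact: A1_max.1 A1b A1t. Qed.

Lemma A2_monotone w r : inv_op A2 w r ->
  forall y b, inv_op A2 y b -> 0 * `|y - w| ^+ 2 <= inner (y - w) (b - r).
Proof.
move=> A2r y b A2b; rewrite mul0r.
exact: (inv_op_maximally_monotone A2_max).1 A2b A2r.
Qed.

(** At a point of [Z] both residual vectors in [fejer_inequality] vanish, leaving a quasi-Fejer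
    inequality with summable errors. *)
Lemma fejer_zero u w (g1 g2 : R) : Z u w -> 0 <= g1 -> 0 <= g2 ->
  (forall t, A1 u t ->
    forall y b, A1 y b -> g1 * `|y - u| ^+ 2 <= inner (y - u) (b - t)) ->
  (forall r, inv_op A2 w r ->
    forall y b, inv_op A2 y b -> g2 * `|y - w| ^+ 2 <= inner (y - w) (b - r)) ->
  [/\ cvgn (fun n => `|x n - u| ^+ 2 + `|v n - w| ^+ 2),
      bounded_sums (fun n => `|x n - p n| ^+ 2 + `|v n - q n| ^+ 2) 1 &
      bounded_sums (fun n => lambda n * 
        (g1 * `|p n - u| ^+ 2 + g2 * `|q n - w| ^+ 2)) 1].
Proof.
move=> [t [c [A1t uc A2w E]]] g10 g20 A1g A2g.
have [e [delta [N [delta0 N1 e0 e_sum step]]]] :=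
  fejer_inequality uc (A1g t A1t) (A2g _ A2w).
pose a n := `|x n - u| ^+ 2 + `|v n - w| ^+ 2.
pose d n := `|x n - p n| ^+ 2 + `|v n - q n| ^+ 2.
pose g n := g1 * `|p n - u| ^+ 2 + g2 * `|q n - w| ^+ 2.
have a0 n : 0 <= a n by rewrite addr_ge0 ?sqr_ge0.
have d0 n : 0 <= d n by rewrite addr_ge0 ?sqr_ge0.
have g0 n : 0 <= g n by rewrite addr_ge0 // mulr_ge0 ?sqr_ge0.
have {}step n : (N <= n)%N -> a n.+1 + (delta * d n + 2 * lambda n * g n) <= a n + e n.
  by move=> /step; rewrite E subrr !inner0l addr0 mulr0 addr0.
have lam0 n : (N <= n)%N -> 0 <= lambda n.
  by move=> Nn; rewrite ltW // lambda_gt0 // (leq_trans N1).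
have b_sum := quasi_fejer_sums a0 step e_sum.
have dd n := mulr_ge0 (ltW delta0) (d0 n).
have lg n Nn := mulr_ge0 (lam0 n Nn) (g0 n).
split.
- apply: (quasi_fejer_cvg a0 step e_sum) => // n Nn.
  by rewrite -mulrA addr_ge0 // mulr_ge0 ?lg.
- apply: (@bounded_sums_start _ _ N).
  apply: (bounded_sums_le _ (bounded_sumsZ (c := delta^-1) _ b_sum)) => [n Nn|].
    rewrite ler_pdivlMl //; have := lg n Nn; rewrite -/(d n); lra.
  by rewrite invr_ge0 ltW.
- apply: (@bounded_sums_start _ _ N); apply: (bounded_sums_le _ b_sum) => n Nn.
  have := lg n Nn; have := dd n; rewrite -/(g n); lra.
Qed.

Let tau_dvg := not_in_ell1_dvg lambda_gt0 h3_l1.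

(** [maximally_monotone_skew_sum] is applied to [A1] plus the normal cone and the inverse of [A2];
    its premise is the limit along [F] of the summed inequality divided by [tau n]. *)
Lemma mean_cluster (F : set_system nat) z y : ProperFilter F -> \oo `<=` F ->
  (forall h, inner (weighted_mean lambda x n) h @[n --> F] --> inner z h) ->
  (forall h, inner (weighted_mean lambda v n) h @[n --> F] --> inner y h) ->
  Z z y.
Proof.
move=> FF oF xz vy.
have [u0 /zer_inclusionP[w0 Z0]] := h1_zer.
have [_ d_sum _] := fejer_zero Z0 (lexx 0) (lexx 0) (@A1_monotone u0) (@A2_monotone w0).
have Smax := inv_op_maximally_monotone A2_max.
have eta0 : 0 <= eta^-1 by rewrite invr_ge0 ltW.
have [|[t A1t [c uc E]] Syz] :=
    maximally_monotone_skew_sum (z := z) (y := y) K_cont h1_max Smax eta0 D_lip.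
  move=> u _ w r [t A1t [c uc <-]] A2r.
  set g := _ + _ + _ + _; set h := r - K u.
  have [e [delta [N [delta0 N1 e0 e_sum step]]]] :=
    fejer_inequality uc (A1_monotone A1t) (A2_monotone A2r).
  pose a n := `|x n - u| ^+ 2 + `|v n - w| ^+ 2.
  pose d n := `|x n - p n| ^+ 2 + `|v n - q n| ^+ 2.
  pose f n := inner (x n - u) g + inner (v n - w) h.
  have f_sum : bounded_sums (fun n => lambda n * f n) 1.
    apply: (@bounded_sums_start _ _ N).
    (* Young's inequality pays for replacing [(p n, q n)] by [(x n, v n)] in the residual terms;
       square summability of [lambda] enters here, and [d_sum] comes from a zero. *)
    pose e' n := e n + (d n + (`|g| ^+ 2 + `|h| ^+ 2) * `|lambda n| ^+ 2).
    have e'_sum : bounded_sums e' N.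
      apply: bounded_sumsD => //; apply: (@bounded_sums_start _ _ 1).
      apply: bounded_sumsD => //; apply: bounded_sumsZ.
        by rewrite addr_ge0 ?sqr_ge0.
      exact: in_ell_bounded h3_l2.
    have a0 n : 0 <= a n by rewrite addr_ge0 ?sqr_ge0.
    have {}step n : (N <= n)%N -> a n.+1 + 2 * (lambda n * f n) <= a n + e' n.
      move=> Nn; have := step n Nn; rewrite -/g -/h -/(a n) -/(a n.+1) -/(d n) !mul0r.
      have dd : 0 <= delta * d n by rewrite mulr_ge0 ?addr_ge0 ?sqr_ge0 // ltW.
      have := sqr_ge0 `|lambda n *: g - (x n - p n)|.
      have := sqr_ge0 `|lambda n *: h - (v n - q n)|.
      rewrite (sqr_normB (lambda n *: g)) (sqr_normB (lambda n *: h)).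
      rewrite !normrZ !exprMn !innerZl; move: dd; rewrite /e' /f /d.
      rewrite (innerC (x n - u)) (innerC (v n - w)) !innerBr; lra.
    have half0 : 0 <= 2^-1 :> R by rewrite invr_ge0.
    apply: bounded_sums_le
      (bounded_sumsZ half0 (quasi_fejer_sums a0 step e'_sum)).
    by move=> n _; rewrite mulrA mulVf ?mul1r.
  have [M fM] := f_sum.
  pose tau n := \sum_(1 <= k < n.+1) lambda k.
  have lim_f : inner (weighted_mean lambda x n) g - inner u g
      + (inner (weighted_mean lambda v n) h - inner w h) @[n --> F] -->
      inner z g - inner u g + (inner y h - inner w h).
    by apply: cvgD; apply: cvgB; [exact: xz|exact: cvg_cst|exact: vy|exact: cvg_cst].
  have lim_0 : (tau n)^-1 * M @[n --> F] --> (0 : R).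
    have := cvg_invM_dvg M tau_dvg.
    by move=> h0 A /h0; exact: oF.
  have : inner z g - inner u g + (inner y h - inner w h) <= 0.
    apply: (ler_cvg_to lim_f lim_0); apply: oF; near=> n.
    have tau0 : 0 < tau n by near: n; exact: cvgry_gt.
    rewrite !inner_weighted_mean -/(tau n).
    rewrite -(ler_pM2l tau0) mulrA divff ?gt_eqF // mul1r.
    apply: le_trans (fM n.+1).
    rewrite le_eqVlt; apply/orP; left; apply/eqP; rewrite /f.
    under [in RHS]eq_bigr do rewrite !innerBl mulrDr !mulrBr.
    rewrite big_split /= !sumrB -!mulr_suml -/(tau n).
    by field; rewrite gt_eqF.
  rewrite !innerBl; lra.
exists t, c; split=> //; rewrite E; inner_ring.
Unshelve. all: by end_near. Qed.

Lemma ergodic_convergence :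
  exists2 z : H, zer (inclusion_op A1 A2 K D C) z &
     weakly_cvg (weighted_mean lambda x) z.
Proof.
have [u0 /zer_inclusionP[w0 Z0]] := h1_zer.
have [|||u [w [Zuw xu]]] := @opial_passty R H G lambda x v Z lambda_gt0 tau_dvg.
- by exists u0, w0.
- move=> u w Zuw.
  by have [] := fejer_zero Zuw (lexx 0) (lexx 0) (@A1_monotone u) (@A2_monotone w).
- exact: mean_cluster.
by exists u => //; apply/zer_inclusionP; exists w.
Qed.

(** [g_sum] controls the distances of [(p n, q n)] to [(u, w)]. Bounded [lambda] and [d_sum]
    transfer this to [(x n, v n)], and the convergent squared distance must then tend to 0. *)
Lemma strong_convergence u : strongly_monotone_op A1 ->
  strongly_monotone_op (inv_op A2) -> zer (inclusion_op A1 A2 K D C) u ->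
  x @ \oo --> u.
Proof.
move=> [g1 g10 A1g] [g2 g20 A2g] /zer_inclusionP[w Zuw].
have [||a_cvg d_sum g_sum] := fejer_zero Zuw (ltW g10) (ltW g20).
- by move=> t A1t y b A1b; exact: A1g.
- by move=> r A2r y b A2b; exact: A2g.
have [L LP] : exists L, forall n, (1 <= n)%N -> lambda n <= L.
  have [L LP] := in_ell_bounded h3_l2; exists (L + 1) => n n1.
  have : `|lambda n| ^+ 2 <= L.
    apply: le_trans (LP n.+1); rewrite big_nat_recr //= lerDr.
    by rewrite sumr_ge0.
  have := ler_norm (lambda n); have := sqr_ge0 (`|lambda n| - 1); nra.
pose a n := `|x n - u| ^+ 2 + `|v n - w| ^+ 2.
have a0 n : 0 <= a n by rewrite addr_ge0 ?sqr_ge0.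
have L0 : 0 <= L by apply: le_trans (LP 1%N _) => //; rewrite ltW // lambda_gt0.
have la_sum : bounded_sums (fun n => lambda n * a n) 1.
  pose g := Num.min g1 g2.
  have g0 : 0 < g by rewrite lt_min g10.
  apply: (bounded_sums_le _ (bounded_sumsD (bounded_sumsZ (c := 2 / g) _ g_sum)
    (bounded_sumsZ (c := 2 * L) _ d_sum))).
  - move=> n n1; have lam0 := lambda_gt0 n1; have lamL := LP n n1.
    have tri (V : hilbertType R) (b c d : V) :
        `|b - d| ^+ 2 <= 2 * (`|c - d| ^+ 2 + `|b - c| ^+ 2).
      have -> : b - d = (b - c) + (c - d) by rewrite addrA subrK.
      have := sqr_ge0 `|(b - c) - (c - d)|.
      rewrite (sqr_normD (b - c) (c - d)) (sqr_normB (b - c) (c - d)); lra.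
    pose P := `|p n - u| ^+ 2 + `|q n - w| ^+ 2.
    pose E := `|x n - p n| ^+ 2 + `|v n - q n| ^+ 2.
    have aPE : a n <= 2 * P + 2 * E.
      have := tri _ (x n) (p n) u; have := tri _ (v n) (q n) w.
      rewrite /a /P /E; lra.
    have gP : P <= g^-1 * (g1 * `|p n - u| ^+ 2 + g2 * `|q n - w| ^+ 2).
      rewrite ler_pdivlMl // mulrDr lerD // ler_wpM2r ?sqr_ge0 //.
        by rewrite ge_min lexx.
      by rewrite ge_min lexx orbT.
    have := ler_wpM2l (ltW lam0) aPE; have := ler_wpM2l (ltW lam0) gP.
    have E0 : 0 <= E by rewrite addr_ge0 ?sqr_ge0.
    have := ler_wpM2r E0 lamL; rewrite -/E; lra.
  - by rewrite divr_ge0 // ltW.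
  - by rewrite mulr_ge0.
have a_lim0 := bounded_weighted_sums_cvg0 lambda_gt0 tau_dvg a0 a_cvg la_sum.
apply/cvgrPdist_le => e e0; near=> n.
have : `|0 - a n| <= e ^+ 2.
  near: n; move/cvgrPdist_le : a_lim0; apply; exact: exprn_gt0.
rewrite sub0r normrN ger0_norm // => a_le.
rewrite -ler_sqr ?nnegrE ?normr_ge0 ?(ltW e0) // distrC.
by apply: le_trans a_le; rewrite lerDl sqr_ge0.
Unshelve. all: by end_near. Qed.

End convergence.


Theorem theorem24 (R : realType) (H G : hilbertType R)
    (A1 : H -> set H) (A2 : G -> set G)
    (A1_max : maximally_monotone_op A1) (A2_max : maximally_monotone_op A2)
    (K : {linear H -> G}) (K_cont : continuous K)
    (D : H -> H) (eta : R) (eta_gt0 : 0 < eta)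
    (D_mono : monotone_op (fun_op D)) (D_lip : (eta^-1).-lipschitz D)
    (B : H -> H) (mu : R) (mu_gt0 : 0 < mu)
    (B_mono : monotone_op (fun_op B)) (B_lip : (mu^-1).-lipschitz B)
    (C : set H) (C_def : C = zer (fun_op B)) (C_neq0 : C !=set0)
    (lambda beta : nat -> R)
    (lambda_gt0 : forall n, (1 <= n)%N -> 0 < lambda n)
    (beta_gt0 : forall n, (1 <= n)%N -> 0 < beta n)
    (x p : nat -> H) (v q : nat -> G)
    (p_def : forall n, (1 <= n)%N ->
       resolvent (scale_op (lambda n) A1)
         (x n - lambda n *: (D (x n) + adjoint K (v n))
              - (lambda n * beta n) *: B (x n)) (p n))
    (q_def : forall n, (1 <= n)%N ->
       resolvent (scale_op (lambda n) (inv_op A2))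
         (v n + lambda n *: K (x n)) (q n))
    (x_rec : forall n, (1 <= n)%N ->
       x n.+1 = (lambda n * beta n) *: (B (x n) - B (p n))
                + lambda n *: (D (x n) - D (p n))
                + lambda n *: adjoint K (v n - q n) + p n)
    (v_rec : forall n, (1 <= n)%N ->
       v n.+1 = lambda n *: K (p n - x n) + q n)
    (h1_max : maximally_monotone_op (add_op A1 (normal_cone C)))
    (h1_zer : zer (inclusion_op A1 A2 K D C) !=set0)
    (h2 : forall w : H, ran (normal_cone C) w ->
       (\sum_(1 <= n <oo) (lambda n * beta n)%:E *
          (ereal_sup [set fitzpatrick (fun_op B) u ((beta n)^-1 *: w)
                     | u in C]
           - support_fun C ((beta n)^-1 *: w)) < +oo)%E)
    (h3_l2 : in_ell 2 lambda) (h3_l1 : ~ in_ell 1 lambda)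
    (h4 : (limn_esup (fun n =>
             (lambda n * beta n / mu
              + lambda n * Num.sqrt (2 * (1 / eta ^+ 2 + opnorm K ^+ 2)))%:E)
           < 1)%E) :
  (exists2 z : H, zer (inclusion_op A1 A2 K D C) z &
     weakly_cvg (weighted_mean lambda x) z)
  /\
  (strongly_monotone_op A1 -> strongly_monotone_op (inv_op A2) ->
   exists2 xbar : H, zer (inclusion_op A1 A2 K D C) = [set xbar] &
     x @ \oo --> xbar).

Proof.
have erg := ergodic_convergence A1_max A2_max K_cont eta_gt0 D_mono D_lip mu_gt0
  B_lip C_def lambda_gt0 beta_gt0 p_def q_def x_rec v_rec h1_max h1_zer h2 h3_l2
  h3_l1 h4.
split=> // A1_strong A2_strong; have [u Zu] := h1_zer.
(* The sequence converges to every zero, so uniqueness of limits also makes the zero unique. *)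
have x_cvg z (Zz : zer (inclusion_op A1 A2 K D C) z) : x @ \oo --> z.
  exact: (strong_convergence K_cont eta_gt0 D_mono D_lip mu_gt0
    B_lip C_def lambda_gt0 beta_gt0 p_def q_def x_rec v_rec h2 h3_l2 h3_l1 h4
    A1_strong A2_strong Zz).
exists u; last exact: x_cvg.
apply/seteqP; split=> [z Zz|_ -> //] /=.
by rewrite -(cvg_lim _ (x_cvg z Zz)) ?(cvg_lim _ (x_cvg u Zu)).
Qed.
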